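(* Let $p>1$. There exists a constant $h_*>0$ such that the following holds. Let $\psi$ be a symmetric cone obstacle satisfying the obstacle assumptions below. (i) If $\psi(\tfrac12) < h_*$, then there is a unique minimizer $u\in M_{\rm sym}(\psi)$ of $\mathcal{E}_p$ in $M_{\rm sym}(\psi)$. (ii) If $\psi(\tfrac12)\ge h_*$, then there is no minimizer of $\mathcal{E}_p$ in $M(\psi)$.
   Context: For $u \in W^{2,p}(0,1)$ let $\kappa_u = u''/(1+(u')^2)^{3/2}$ be the curvature of its graph and $\mathcal{E}_p(u) := \int_0^1 |\kappa_u|^p\sqrt{1+(u')^2}\,dx$ (equivalently $\mathcal{E}_p(u)=\int_0^1|(EU_p(u'))'|^p dx$ with $EU_p(z)=\int_0^z(1+s^2)^{-\frac32+\frac1{2p}}ds$). Obstacle assumptions: $\psi\in C^0([0,1])$, $\psi(0)<0$, $\psi(1)<0$, and $\psi(x_0)>0$ for some $x_0\in(0,1)$. A symmetric cone obstacle is a $\psi\in C^0([0,1])$ such that $\psi|_{[0,1/2]}$ and $\psi|_{[1/2,1]}$ are affine linear and $\psi(x)=\psi(1-x)$ for $x\in[0,1]$. $M(\psi) := \{ v \in W^{2,p}(0,1)\cap W^{1,p}_0(0,1) : v \ge \psi \text{ on } [0,1]\}$ and $M_{\rm sym}(\psi) := \{ v\in M(\psi) : v(x)=v(1-x) \text{ for } x\in[0,1]\}$. *)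

(* Defs.v *)
From HB Require Import structures.
From mathcomp Require Import all_boot all_order all_algebra.
From mathcomp Require Import all_classical all_reals all_analysis.
Set Implicit Arguments. Unset Strict Implicit. Unset Printing Implicit Defensive.
Import Order.TTheory GRing.Theory Num.Theory.
Import numFieldNormedType.Exports.
Local Open Scope classical_set_scope.
Local Open Scope ring_scope.

Section Defs.
Variable R : realType.
Local Notation mu := (@lebesgue_measure R).
Definition I01 : set R := `[0%R, 1%R].

(* u (a function R -> R, only its values on [0,1] matter) lies in W^{2,p}(0,1)
   (continuous representative): there are c and g in L^p(0,1) with
   u(x) = u(0) + int_0^x (c + int_0^t g) for all x in [0,1]. *)
Definition W2p (p : R) (u : R -> R) : Prop :=
  exists (c : R) (g : R -> R),
    measurable_fun I01 g /\
    mu.-integrable I01 (EFin \o g) /\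
    (\int[mu]_(x in I01) ((`|g x| `^ p)%:E) < +oo)%E /\
    forall x, 0 <= x <= 1 ->
      u x = u 0 + Rintegral mu (`[0%R, x] : set R)
                    (fun t => c + Rintegral mu (`[0%R, t] : set R) g).

Definition curv (u : R -> R) (x : R) : R :=
  (derive1 (derive1 u)) x / (Num.sqrt (1 + (derive1 u x) ^+ 2)) ^+ 3.

Definition Ep (p : R) (u : R -> R) : \bar R :=
  (\int[mu]_(x in I01)
     ((`|curv u x| `^ p * Num.sqrt (1 + (derive1 u x) ^+ 2))%:E))%E.

Definition obstacle_assumptions (psi : R -> R) : Prop :=
  {within I01, continuous psi} /\ psi 0 < 0 /\ psi 1 < 0 /\
  exists x0, 0 < x0 < 1 /\ 0 < psi x0.

Definition sym_cone (psi : R -> R) : Prop :=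
  {within I01, continuous psi} /\
  (exists a b : R, forall x, 0 <= x <= 1 / 2 -> psi x = a * x + b) /\
  (exists a b : R, forall x, 1 / 2 <= x <= 1 -> psi x = a * x + b) /\
  (forall x, 0 <= x <= 1 -> psi x = psi (1 - x)).

Definition Mset (p : R) (psi : R -> R) (v : R -> R) : Prop :=
  W2p p v /\ v 0 = 0 /\ v 1 = 0 /\ forall x, 0 <= x <= 1 -> psi x <= v x.

Definition Msym (p : R) (psi : R -> R) (v : R -> R) : Prop :=
  Mset p psi v /\ forall x, 0 <= x <= 1 -> v x = v (1 - x).

Definition is_minimizer (p : R) (M : (R -> R) -> Prop) (u : R -> R) : Prop :=
  M u /\ forall v, M v -> (Ep p u <= Ep p v)%E.

End Defs.

(* Main.v *)
Require Import Defs.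
From mathcomp Require Import all_boot all_order all_algebra.
From mathcomp Require Import all_classical all_reals all_analysis.
From mathcomp Require Import measurable_realfun lra ring.
Set Implicit Arguments. Unset Strict Implicit. Unset Printing Implicit Defensive.
Import Order.TTheory GRing.Theory Num.Theory.
Import numFieldNormedType.Exports.
Local Open Scope classical_set_scope.
Local Open Scope ring_scope.

(** Put [m = (1 - 1/p)/2], [G z = int_0^z (1 + s^2)^(-1-m) ds] (the paper's
    [EU_p]) and [K = G(+oo)]; then [E_p u = int |(G u')'|^p]. If [u'] decreases
    from its maximum [1/t] to [0], Young's inequality with the weight
    [kap^p (1 - t u')] bounds the energy from below by
    [p kap^(p-1) rho t - (p-1) kap^p int (1 - t u')], where
    [rho t = int_0^(1/t) G'(z) (1 - t z)^(2m) dz = (1 + t^2)^m (K - G t)]; the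
    closed form comes from rotating the graph by the angle [arctan t]. Since
    [rho] is strictly convex, its tangent lines turn this into a bound that no
    longer involves the unknown slope [1/t]. The tangent at [t = 0] gives
    [E_p u > (2K)^p] as soon as [u] reaches the height
    [hstar = p / (2 (p-1) K) = 1 / (4 m K)], whereas graphs with steep initial
    segments have energy arbitrarily close to [(2K)^p]: this is (ii). Below
    [hstar] there is a tangent point [t > 0] for which a free elastica attains
    the bound, and equality forces [|(G u')'| = kap (1 - t u')^(1/p)], an
    autonomous equation whose only admissible solution is that elastica. *)

(** The weight answers two demands at once. With B = kap (1 - t u')^(1/p), the term B^p is affine in
    u', so its integral over one side sees the unknown function only through the length of the side
    and the height climbed. And since (p-1)/p = 2m, the term B^(p-1) |(G u')'| is a multiple of
    |(Phi(u'))'| for a function Phi of the slope alone; its integral is at least the difference of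
    the values of Phi at a point of slope 1/t and at a point of slope 0, however u' moves between
    them. The bound is applied on each side of an interior point of slope 0, with one common kap but
    two slopes 1/t1 and 1/t2. Sharing kap makes the two lengths add up to 1, so the position of that
    point drops out. No compactness is involved: existence in (i) is the coincidence of the bound
    with the energy of an explicit curve. The technical obstacle is low regularity. The slope is
    only absolutely continuous, so the chain rule is replaced by an inequality proved by continuous
    induction, and the second derivative inside [Ep] is a pointwise one, under control only almost
    everywhere. *)

Section RealCalculus.
Variable R : realType.
Local Notation mu := (@lebesgue_measure R).
Implicit Types (f g : R -> R) (a b c x : R).

(** * Derivative rules, mean value theorem and fundamental theorem of calculus on segments *)

Lemma is_derive1D f g x a b : is_derive x 1 f a -> is_derive x 1 g b ->
  is_derive x 1 (fun s => f s + g s) (a + b).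
Proof. exact: is_deriveD. Qed.

Lemma is_derive1N f x a : is_derive x 1 f a ->
  is_derive x 1 (fun s => - f s) (- a).
Proof. exact: is_deriveN. Qed.

Lemma is_derive1B f g x a b : is_derive x 1 f a -> is_derive x 1 g b ->
  is_derive x 1 (fun s => f s - g s) (a - b).
Proof. exact: is_deriveB. Qed.

Lemma is_derive1M f g x a b : is_derive x 1 f a -> is_derive x 1 g b ->
  is_derive x 1 (fun s => f s * g s) (f x * b + g x * a).
Proof. exact: is_deriveM. Qed.

Lemma is_derive1Zl c f x a : is_derive x 1 f a ->
  is_derive x 1 (fun s => c * f s) (c * a).
Proof. exact: is_deriveZ. Qed.

Lemma is_derive1V f x a : f x != 0 -> is_derive x 1 f a ->
  is_derive x 1 (fun s => (f s)^-1) (- a / f x ^+ 2).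
Proof.
move=> fx0 df; have h := is_deriveV fx0 df.
apply: (is_derive_eq h).
by rewrite /GRing.scale /=; ring.
Qed.

Lemma is_derive1_compo f g x a b : is_derive (g x) 1 f a -> is_derive x 1 g b ->
  is_derive x 1 (fun s => f (g s)) (a * b).
Proof. exact: is_derive1_comp. Qed.

Lemma is_derive1_cst c x : is_derive x 1 (fun=> c) (0 : R).
Proof. exact: is_derive_cst. Qed.

Lemma is_derive1_id x : is_derive x 1 (fun s => s) (1 : R).
Proof. exact: is_derive_id. Qed.

Lemma is_derive1_near_eq f g x a : {near x, f =1 g} -> is_derive x 1 f a ->
  is_derive x 1 g a.
Proof.
move=> fg [df <-]; apply: DeriveDef; first exact: near_eq_derivable fg df.
by apply/esym/near_eq_derive.
Qed.

Lemma is_derive1_continuous f x a : is_derive x 1 f a -> {for x, continuous f}.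
Proof.
by move=> [df _]; apply/differentiable_continuous/derivable1_diffP.
Qed.

Lemma is_derive1_powR_1Dsqr (r x : R) :
  is_derive x 1 (fun s => (1 + s ^+ 2) `^ r)
    (2 * r * x * (1 + x ^+ 2) `^ (r - 1)).
Proof.
have h : 0 < 1 + x ^+ 2 by rewrite ltr_pwDl// sqr_ge0.
have dq : is_derive x 1 (fun s => 1 + s * s) (0 + (x * 1 + x * 1)).
  exact: is_derive1D (is_derive1_cst _ _)
    (is_derive1M (is_derive1_id _) (is_derive1_id _)).
have d := @is_derive1_compo (fun v => v `^ r) (fun s => 1 + s * s) x _ _
  (is_derive1_powR r h) dq.
by apply: (is_derive_eq d); rewrite expr2; ring.
Qed.

Lemma MVT_everywhere f (df : R -> R) a b : a < b ->
  (forall x, a <= x <= b -> is_derive x 1 f (df x)) ->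
  exists2 c, a < c < b & f b - f a = df c * (b - a).
Proof.
move=> ab h; have [||c cab e] := @MVT R f df a b ab.
- by move=> x; rewrite in_itv/= => /andP[/ltW ax /ltW xb]; apply: h; rewrite ax.
- apply: continuous_in_subspaceT => x; rewrite inE/= in_itv/= => xab.
  exact: is_derive1_continuous (h _ xab).
- by exists c => //; move: cab; rewrite in_itv.
Qed.

Lemma is_derive1_lt f (df : R -> R) a b : a < b ->
  (forall x, a <= x <= b -> is_derive x 1 f (df x)) ->
  (forall x, a < x < b -> 0 < df x) -> f a < f b.
Proof.
move=> ab d p; have [c cab e] := MVT_everywhere ab d.
by rewrite -subr_gt0 e mulr_gt0 ?p ?subr_gt0.
Qed.

Lemma continuous_segment_integrable f a b : {within `[a, b], continuous f} ->
  mu.-integrable `[a, b] (EFin \o f).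
Proof.
by move=> cf; apply: continuous_compact_integrable => //; exact: segment_compact.
Qed.

Lemma Rintegral_segment_cat f a b c : a <= b -> b <= c ->
  mu.-integrable `[a, c] (EFin \o f) ->
  \int[mu]_(x in `[a, c]) f x =
  \int[mu]_(x in `[a, b]) f x + \int[mu]_(x in `[b, c]) f x.
Proof.
move=> ab bc fi.
have sub : `]b, c] `<=` `[a, c].
  by apply: subset_itvr; rewrite bnd_simp.
have := @Rintegral_itvB R f (BLeft a) (BRight c) b fi; rewrite !bnd_simp.
move=> /(_ ab bc) e; rewrite -(@Rintegral_itv_obnd_cbnd R b (BRight c)); first by rewrite -e; ring.
by apply: integrableS fi.
Qed.

Lemma Rintegral_segment0 f a : \int[mu]_(x in `[a, a]) f x = 0.
Proof. by rewrite set_itv1 Rintegral_set1. Qed.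

Lemma Rintegral_segment_gt f a b : b < a -> \int[mu]_(x in `[a, b]) f x = 0.
Proof. by move=> ba; rewrite set_itv_ge ?Rintegral_set0// bnd_simp -ltNge. Qed.

Lemma Rintegral_segment_cst c a b : a <= b ->
  \int[mu]_(x in `[a, b]) c = c * (b - a).
Proof.
move=> ab; rewrite Rintegral_cst//= lebesgue_measure_itv/= lte_fin.
case: ltP => [_|ba]; first by rewrite -EFinD.
by have -> : a = b; [apply/le_anti; rewrite ab ba|rewrite subrr].
Qed.

Lemma FTC2_segment f (df : R -> R) a b : a <= b ->
  {within `[a, b], continuous f} -> {within `[a, b], continuous df} ->
  (forall x, a < x < b -> is_derive x 1 f (df x)) ->
  \int[mu]_(x in `[a, b]) df x = f b - f a.
Proof.
rewrite le_eqVlt => /predU1P[-> *|ab cf cdf d].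
  by rewrite Rintegral_segment0 subrr.
have [_ fa fb] := (continuous_within_itvP f ab).1 cf.
rewrite /Rintegral (@continuous_FTC2 R df f a b)//.
- split=> // x; rewrite in_itv/= => /d h; exact: ex_derive.
- move=> x; rewrite in_itv/= => /d h; rewrite derive1E; exact: derive_val.
Qed.

(** Serves the extremal curve, whose derivative formulas are available only away from finitely many
    corners. Induction on the list: an exceptional point inside the segment splits it in two, one
    outside is discarded. *)
Lemma FTC2_except (cs : seq R) f (df : R -> R) a b :
  continuous f -> continuous df -> a <= b ->
  (forall x, a < x < b -> x \notin cs -> is_derive x 1 f (df x)) ->
  \int[mu]_(x in `[a, b]) df x = f b - f a.
Proof.
move=> cf cdf; elim: cs a b => [|c cs IH] a b ab d.
  apply: FTC2_segment => //; try exact: continuous_subspaceT.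
  by move=> x /d; apply.
have [/andP[ac cb]|nc] := boolP (a < c < b); last first.
  apply: IH => // x xab xcs; apply: d => //; rewrite inE negb_or xcs andbT.
  by apply: contra nc => /eqP <-.
rewrite (@Rintegral_segment_cat df a c b) ?(ltW ac) ?(ltW cb)//; last first.
  by apply: continuous_segment_integrable; exact: continuous_subspaceT.
have -> : \int[mu]_(x in `[a, c]) df x = f c - f a.
  apply: IH (ltW ac) _ => x /andP[ax xc] xcs; apply: d.
    by rewrite ax (lt_trans xc).
  by rewrite inE negb_or xcs andbT lt_eqF.
have -> : \int[mu]_(x in `[c, b]) df x = f b - f c.
  apply: IH (ltW cb) _ => x /andP[cx xb] xcs; apply: d.
    by rewrite xb (lt_trans ac).
  by rewrite inE negb_or xcs andbT gt_eqF.
by ring.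
Qed.

(** Oriented integral from 0: the integral over a reversed segment is 0, so only the term matching
    the sign of [x] contributes. *)
Definition primitive f x :=
  \int[mu]_(t in `[0, x]) f t - \int[mu]_(t in `[x, 0]) f t.

Lemma primitiveE f a x : a <= 0 -> a <= x -> continuous f ->
  primitive f x = \int[mu]_(t in `[a, x]) f t - \int[mu]_(t in `[a, 0]) f t.
Proof.
move=> a0 ax cf.
have fi b c : mu.-integrable `[b, c] (EFin \o f).
  by apply: continuous_segment_integrable; exact: continuous_subspaceT.
rewrite /primitive; case: (lerP 0 x) => x0.
  rewrite (@Rintegral_segment_cat f a 0 x)//.
  move: x0; rewrite le_eqVlt => /predU1P[<-|x0].
    by rewrite !Rintegral_segment0; ring.
  by rewrite (@Rintegral_segment_gt f x 0 x0); ring.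
rewrite (@Rintegral_segment_gt f 0 x x0).
by rewrite (@Rintegral_segment_cat f a x 0)// ?ltW//; ring.
Qed.

Lemma is_derive_primitive f x : continuous f ->
  is_derive x 1 (primitive f) (f x).
Proof.
(* This base point lies to the left of both 0 and [x], so near [x] the primitive is an ordinary
   integral from [a] minus a constant. *)
move=> cf; set a := - (`|x| + 1).
have a0 : a < 0 by rewrite /a oppr_lt0 ltr_pwDr.
have ax : a < x by rewrite /a; have := ler_norm (- x); rewrite normrN; lra.
pose F (y : R) : R := \int[mu]_(t in `[a, y]) f t.
have fi b c : mu.-integrable `[b, c] (EFin \o f).
  by apply: continuous_segment_integrable; exact: continuous_subspaceT.
have [dF eF] : derivable F x 1 /\ derive1 F x = f x.
  by apply: (@continuous_FTC1_closed R f a x (x + 1)) => //; [rewrite ltrDl|exact: cf].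
have dF' : is_derive x 1 F (f x).
  by apply: DeriveDef; [exact: dF|rewrite -derive1E; exact: eF].
have dF2 : is_derive x 1 (fun y => F y - F 0) (f x - 0).
  exact: is_derive1B dF' (is_derive1_cst _ _).
rewrite subr0 in dF2; apply: is_derive1_near_eq dF2.
near=> y; apply/esym; apply: primitiveE => //; first exact: ltW.
by apply/ltW; near: y; exact: lt_nbhsr.
Unshelve. all: by end_near. Qed.

End RealCalculus.

(** * The functions [G], [rho] and the rotated primitive [Phi] *)

Section Profile.
Variables (R : realType) (m : R).
Hypotheses (m_gt0 : 0 < m) (m_lt12 : m < 1 / 2).
Implicit Types (s t x y z : R).

Lemma sq1_gt0 s : 0 < 1 + s ^+ 2.
Proof. by rewrite ltr_pwDl// sqr_ge0. Qed.

#[local] Hint Resolve sq1_gt0 : core.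

Definition dG s := (1 + s ^+ 2) `^ (- 1 - m).
Definition G := primitive dG.
(** The tail integral of [s * dG s] from [s] to infinity, in closed form. *)
Definition eta s := (1 + s ^+ 2) `^ (- m) / (2 * m).

Lemma dG_gt0 s : 0 < dG s. Proof. exact: powR_gt0. Qed.

Lemma dGN s : dG (- s) = dG s. Proof. by rewrite /dG sqrrN. Qed.

Lemma dGE s : dG s = ((1 + s ^+ 2) `^ m)^-1 / (1 + s ^+ 2).
Proof.
rewrite /dG powRD; last by rewrite (gt_eqF (sq1_gt0 s)) implybT.
by rewrite powR_inv1 ?ltW// powRN mulrC.
Qed.

Lemma dG_le1 s : dG s <= 1.
Proof.
have h1 : 1 <= 1 + s ^+ 2 by rewrite lerDl sqr_ge0.
have e : - 1 - m <= 0 by have := m_gt0; lra.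
by rewrite -[leRHS](powRr0 (1 + s ^+ 2)) /dG; apply: ler_powR.
Qed.

Lemma continuous_dG : continuous dG.
Proof. by move=> s; apply: is_derive1_continuous (is_derive1_powR_1Dsqr _ _). Qed.

Lemma is_derive_G s : is_derive s 1 G (dG s).
Proof. by apply: is_derive_primitive; exact: continuous_dG. Qed.

Lemma G0 : G 0 = 0.
Proof. by rewrite /G /primitive Rintegral_segment0 subrr. Qed.

Lemma G_lt s t : s < t -> G s < G t.
Proof.
move=> st; apply: (is_derive1_lt st) => [x _|x _]; first exact: is_derive_G.
exact: dG_gt0.
Qed.

Lemma G_le s t : s <= t -> G s <= G t.
Proof. by rewrite le_eqVlt => /predU1P[->//|/G_lt/ltW]. Qed.

Lemma eta_gt0 s : 0 < eta s.
Proof. by rewrite divr_gt0 ?powR_gt0// mulr_gt0. Qed.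

Lemma is_derive_eta s : is_derive s 1 eta (- (s * dG s)).
Proof.
have d := is_derive1Zl (2 * m)^-1 (is_derive1_powR_1Dsqr (- m) s).
have d' : is_derive s 1 eta ((2 * m)^-1 * (2 * - m * s * (1 + s ^+ 2) `^ (- m - 1))).
  by move: d; congr is_derive; apply/funext => x; rewrite /eta mulrC.
apply: (is_derive_eq d'); rewrite /dG (addrC (- 1)).
by field; rewrite gt_eqF.
Qed.

(** On the segment from [t] to [s] the integrand [t * dG x] is at most [x * dG x], which [- eta]
    integrates. This gives both the finiteness of [K] and the bound on its tail. *)
Lemma G_sub_le t s : 0 < t -> t <= s -> t * (G s - G t) <= eta t - eta s.
Proof.
move=> t0; rewrite le_eqVlt => /predU1P[->|ts]; first by rewrite !subrr mulr0.
pose f x := - eta x - t * G x.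
have d x : is_derive x 1 f ((x - t) * dG x).
  have d := is_derive1B (is_derive1N (is_derive_eta x)) (is_derive1Zl t (is_derive_G x)).
  by apply: (is_derive_eq d); ring.
have := @is_derive1_lt R f _ t s ts (fun x _ => d x).
have h x : t < x < s -> 0 < (x - t) * dG x.
  by move=> /andP[tx _]; rewrite mulr_gt0 ?dG_gt0// subr_gt0.
by move=> /(_ h); rewrite /f; lra.
Qed.

(** Since [G] is increasing, this supremum is its limit at infinity. *)
Definition K := sup (range G).

Lemma G_has_sup : has_sup (range G).
Proof.
split; first by exists (G 0); exists 0.
exists (G 1 + eta 1) => _ [y _ <-].
have [y1|y1] := leP 1 y.
  by have := G_sub_le ltr01 y1; have := eta_gt0 y; lra.
by have := G_lt y1; have := eta_gt0 1; lra.
Qed.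

Lemma G_ltK y : G y < K.
Proof.
have := @G_lt y (y + 1); rewrite ltrDl => /(_ ltr01)/lt_le_trans; apply.
apply: sup_upper_bound; first exact: G_has_sup.
by exists (y + 1).
Qed.

Lemma K_le y0 (C : R) : (forall y, y0 <= y -> G y <= C) -> K <= C.
Proof.
move=> h; apply: sup_le_ub; first by exists (G 0); exists 0.
move=> _ [y _ <-]; apply: le_trans (h (Num.max y0 y) _); last by rewrite le_max lexx.
by apply: G_le; rewrite le_max lexx orbT.
Qed.

Lemma K_gt0 : 0 < K.
Proof. by rewrite -G0 G_ltK. Qed.

Definition tailG y := K - G y.

Lemma tailG_gt0 y : 0 < tailG y. Proof. by rewrite subr_gt0 G_ltK. Qed.

Lemma is_derive_tailG y : is_derive y 1 tailG (- dG y).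
Proof.
have d := is_derive1B (is_derive1_cst K y) (is_derive_G y).
by apply: (is_derive_eq d); ring.
Qed.

Lemma tailG_le t : 0 < t -> t * tailG t <= eta t.
Proof.
move=> t0; rewrite mulrC -ler_pdivlMr// /tailG lerBlDr.
apply: (@K_le t) => y ty; rewrite -lerBlDr ler_pdivlMr// mulrC.
by have := G_sub_le t0 ty; have := eta_gt0 y; lra.
Qed.

Definition rho t := (1 + t ^+ 2) `^ m * tailG t.
Definition drho t := (2 * m * t * rho t - 1) / (1 + t ^+ 2).

Lemma rho_gt0 t : 0 < rho t. Proof. by rewrite mulr_gt0 ?powR_gt0 ?tailG_gt0. Qed.

Lemma rho0 : rho 0 = K.
Proof. by rewrite /rho /tailG G0 expr0n/= addr0 powR1 subr0 mul1r. Qed.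

Lemma drho0 : drho 0 = - 1.
Proof. by rewrite /drho mulr0 mul0r expr0n/= addr0 sub0r divr1. Qed.

(** This is [tailG_le] with the power of [1 + t ^+ 2] moved to the other side. It yields the
    convexity of [rho] and the nonnegativity of the height of an elastica. *)
Lemma rho_le t : 0 <= t -> 2 * m * t * rho t <= 1.
Proof.
rewrite le_eqVlt => /predU1P[<-|t0]; first by rewrite mulr0 mul0r.
have := tailG_le t0; rewrite /rho /eta powRN ler_pdivlMr ?mulr_gt0//.
set P := _ `^ m; have P0 : 0 < P by exact: powR_gt0.
rewrite -(ler_pM2l P0) divff ?gt_eqF//; apply: le_trans.
by rewrite le_eqVlt; apply/orP; left; apply/eqP; ring.
Qed.

Lemma is_derive_rho t : is_derive t 1 rho (drho t).
Proof.
have d := is_derive1M (is_derive1_powR_1Dsqr m t) (is_derive_tailG t).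
apply: (is_derive_eq d); rewrite /drho /rho dGE powRB; last first.
  by rewrite (gt_eqF (sq1_gt0 t)) implybT.
rewrite powRr1 ?ltW//.
set P := _ `^ m; have P0 : 0 < P by exact: powR_gt0.
by field; rewrite !gt_eqF.
Qed.

Definition ddrho t :=
  (2 * m * (1 + t ^+ 2) * rho t + (2 - 2 * m) * t * (1 - 2 * m * t * rho t))
    / (1 + t ^+ 2) ^+ 2.

Lemma is_derive_drho t : is_derive t 1 drho (ddrho t).
Proof.
have d1 := is_derive1M (is_derive1Zl (2 * m) (is_derive1_id t)) (is_derive_rho t).
have d2 := is_derive1B d1 (is_derive1_cst 1 t).
have d3 := is_derive1D (is_derive1_cst 1 t)
  (is_derive1M (is_derive1_id t) (is_derive1_id t)).
have n0 : 1 + t * t != 0 by rewrite -expr2 gt_eqF.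
have d := is_derive1M d2 (is_derive1V (f := fun s => 1 + s * s) n0 d3).
apply: (is_derive_eq d); rewrite /ddrho /drho.
by field; rewrite gt_eqF.
Qed.

(** In the numerator the first summand is positive and the second is nonnegative by [rho_le] and
    [m < 1]. *)
Lemma ddrho_gt0 t : 0 <= t -> 0 < ddrho t.
Proof.
move=> t0; rewrite divr_gt0 ?exprn_gt0// ltr_pwDl//.
  by apply: mulr_gt0 (rho_gt0 t); rewrite !mulr_gt0.
by rewrite !mulr_ge0// ?subr_ge0 ?rho_le//; have := m_lt12; lra.
Qed.

Lemma drho_lt s t : 0 <= s -> s < t -> drho s < drho t.
Proof.
move=> s0 st; apply: (@is_derive1_lt R drho ddrho) => // x.
  by move=> _; exact: is_derive_drho.
by move=> /andP[sx _]; apply: ddrho_gt0; rewrite (le_trans s0)// ltW.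
Qed.

Lemma rho_tangent t0 t : 0 <= t0 -> 0 <= t -> t != t0 ->
  rho t0 + drho t0 * (t - t0) < rho t.
Proof.
move=> h0 ht; rewrite neq_lt => /orP[tt0|t0t].
  have [c /andP[tc ct0] e] := MVT_everywhere tt0 (fun x _ => is_derive_rho x).
  have : drho c * (t0 - t) < drho t0 * (t0 - t).
    by rewrite ltr_pM2r ?subr_gt0// drho_lt// (le_trans ht)// ltW.
  by rewrite -e; lra.
have [c /andP[tc ct0] e] := MVT_everywhere t0t (fun x _ => is_derive_rho x).
have : drho t0 * (t - t0) < drho c * (t - t0).
  by rewrite ltr_pM2r ?subr_gt0// drho_lt.
by rewrite -e; lra.
Qed.

(** The equation says that the elastica with initial slope [1 / t] and no straight segments has
    height [h]; it is solved by the intermediate value theorem, and the threshold on [h] is exactly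
    [f 0 < 1]. *)
Lemma exists_slope (h : R) : 0 < h -> h < (4 * m * K)^-1 ->
  exists2 t, 0 < t & 2 * h * (2 * m * rho t + t) = 1 - 2 * m * t * rho t.
Proof.
move=> h0 hK; pose f t := 2 * h * (2 * m * rho t + t) + 2 * m * t * rho t.
have d t : is_derive t 1 f (2 * h * (2 * m * drho t + 1) +
    (2 * m * t * drho t + rho t * (2 * m * 1))).
  exact: (is_derive1D (is_derive1Zl (2 * h) (is_derive1D
     (is_derive1Zl (2 * m) (is_derive_rho t)) (is_derive1_id t)))
     (is_derive1M (is_derive1Zl (2 * m) (is_derive1_id t)) (is_derive_rho t))).
(* At this point the summand [2 * h * t] of [f] alone equals 1, and the others are positive. *)
set T := (2 * h)^-1; have T0 : 0 < T by rewrite invr_gt0 mulr_gt0.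
have [||t] := @IVT R f 0 T 1 (ltW T0).
- apply: continuous_subspaceT => x; exact: is_derive1_continuous (d x).
- have f0 : f 0 < 1.
    rewrite /f rho0 mulr0 mul0r !addr0.
    have K0 : 0 < 4 * m * K by rewrite !mulr_gt0// K_gt0.
    by have := hK; rewrite -[_^-1]mul1r ltr_pdivlMr//; lra.
  have fT : 1 <= f T.
    have e : 2 * h * T = 1 by rewrite /T divff// gt_eqF// mulr_gt0.
    have p1 : 0 < 2 * h * (2 * m * rho T).
      by apply: mulr_gt0; [rewrite mulr_gt0|apply: mulr_gt0 (rho_gt0 T); rewrite mulr_gt0].
    have p2 : 0 < 2 * m * T * rho T.
      by apply: mulr_gt0 (rho_gt0 T); rewrite !mulr_gt0.
    by rewrite /f mulrDr e; lra.
  by rewrite ge_min le_max (ltW f0) fT orbT.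
rewrite in_itv/= => /andP[t0 tT] e; exists t.
  rewrite lt_neqAle t0 andbT; apply/eqP => t00; move: e; rewrite -t00 /f.
  rewrite rho0 mulr0 mul0r !addr0 => e.
  have K0 : 0 < 4 * m * K by rewrite !mulr_gt0// K_gt0.
  by have := hK; rewrite -[_^-1]mul1r ltr_pdivlMr//; lra.
by move: e; rewrite /f; lra.
Qed.

(** The truncation at 0 makes the fractional power continuous on the whole line; only slopes with
    [t * z <= 1] matter. *)
Definition phi t z := dG z * (Num.max 0 (1 - t * z)) `^ (2 * m).

(* Rotating the graph by the angle [arctan t] turns the slope [z] into
   [(z + t) / (1 - t z)]; this makes the primitive of [phi t] explicit. *)
Definition Phi t z :=
  if t * z < 1 then (1 + t ^+ 2) `^ m * (G ((z + t) / (1 - t * z)) - G t)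
  else rho t.

Let PhiI t z := (1 + t ^+ 2) `^ m * (G ((z + t) / (1 - t * z)) - G t).

Lemma phi_ge0 t z : 0 <= phi t z.
Proof. by rewrite mulr_ge0 ?powR_ge0// ltW// dG_gt0. Qed.

Lemma Phi0 t : Phi t 0 = 0.
Proof. by rewrite /Phi mulr0 ltr01 add0r subr0 divr1 subrr mulr0. Qed.

Lemma Phi_top t : 0 < t -> Phi t t^-1 = rho t.
Proof. by move=> t0; rewrite /Phi divff ?gt_eqF// ltxx. Qed.

Lemma dG_rotate t z : t * z < 1 -> dG ((z + t) / (1 - t * z)) =
  dG z * dG t * ((1 - t * z) `^ (2 * m) * (1 - t * z) ^+ 2).
Proof.
move=> tz; have D0 : 0 < 1 - t * z by rewrite subr_gt0.
have n0 : 1 - t * z != 0 by rewrite gt_eqF.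
have e : 1 + ((z + t) / (1 - t * z)) ^+ 2 =
    (1 + z ^+ 2) * (1 + t ^+ 2) * (1 - t * z) `^ (- 2).
  by rewrite (@powR_invn R _ 2) ?ltW//; field.
rewrite {1}/dG e powRM ?powR_ge0 ?mulr_ge0 ?ltW//.
rewrite powRM ?ltW// -/(dG z) -/(dG t) -powRrM; congr (_ * _).
have -> : - 2 * (- 1 - m) = 2 * m + 2 by ring.
rewrite powRD; last by rewrite n0 implybT.
by rewrite (@powR_mulrn R _ 2) ?ltW.
Qed.

Lemma is_derive_PhiI t z : t * z < 1 -> is_derive z 1 (PhiI t) (phi t z).
Proof.
move=> tz; have D0 : 0 < 1 - t * z by rewrite subr_gt0.
have n0 : 1 - t * z != 0 by rewrite gt_eqF.
have d1 := is_derive1B (is_derive1_cst 1 z) (is_derive1Zl t (is_derive1_id z)).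
have d2 := is_derive1M (is_derive1D (is_derive1_id z) (is_derive1_cst t z))
  (is_derive1V (f := fun s => 1 - t * s) n0 d1).
have d3 := is_derive1_compo (g := fun s => (s + t) / (1 - t * s))
  (is_derive_G ((z + t) / (1 - t * z))) d2.
have d := is_derive1Zl ((1 + t ^+ 2) `^ m) (is_derive1B d3 (is_derive1_cst (G t) z)).
apply: (is_derive_eq d); rewrite /phi max_r ?ltW//.
rewrite dG_rotate//.
rewrite (dGE t); set P := _ `^ m; have P0 : 0 < P by exact: powR_gt0.
by field; rewrite n0 !gt_eqF.
Qed.

Lemma PhiI_bounds t s1 s2 M : s1 <= s2 -> 0 < t -> t * s2 < 1 ->
  (forall s, s1 <= s <= s2 -> phi t s <= M) ->
  0 <= PhiI t s2 - PhiI t s1 <= M * (s2 - s1).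
Proof.
rewrite le_eqVlt => /predU1P[->|s12] t0 ts2 hM; first by rewrite !subrr mulr0 lexx.
have [c /andP[s1c cs2] ->] : exists2 c, s1 < c < s2 & PhiI t s2 - PhiI t s1 = phi t c * (s2 - s1).
  apply: MVT_everywhere => // x /andP[_ xs2]; apply: is_derive_PhiI.
  by apply: le_lt_trans ts2; rewrite ler_pM2l.
have p : 0 < s2 - s1 by rewrite subr_gt0.
by rewrite mulr_ge0 ?phi_ge0 ?(ltW p)//= ler_pM2r// hM// !ltW.
Qed.

(** The mean value inequality is extended up to the vertical direction [s2 = t^-1] of the rotated
    graph. There [Phi] is defined through [K], and the supremum property of [K] takes the place of a
    derivative. *)
Lemma Phi_bounds t s1 s2 M : 0 < t -> s1 <= s2 -> t * s2 <= 1 ->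
  (forall s, s1 <= s <= s2 -> phi t s <= M) ->
  `|Phi t s2 - Phi t s1| <= M * (s2 - s1).
Proof.
move=> t0 s12 ts2 hM.
have M0 : 0 <= M by apply: le_trans (hM s1 _); rewrite ?phi_ge0// lexx s12.
have [ts2'|ts2'] := ltP (t * s2) 1.
  have ts1 : t * s1 < 1 by apply: le_lt_trans ts2'; rewrite ler_pM2l.
  have /andP[h1 h2] := PhiI_bounds s12 t0 ts2' hM.
  by rewrite /Phi ts2' ts1 -/(PhiI t s2) -/(PhiI t s1) ger0_norm.
rewrite {1}/Phi ltNge ts2' /=.
have {ts2 ts2'} e2 : s2 = t^-1.
  have : t * s2 = 1 by apply/le_anti; rewrite ts2 ts2'.
  by move=> e; rewrite -[RHS]mulr1 -e mulKf// gt_eqF.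
rewrite /Phi; case: ltP => ts1; last first.
  by rewrite subrr normr0 mulr_ge0// subr_ge0.
rewrite -/(PhiI t s1) ger0_norm; last first.
  rewrite subr_ge0 /PhiI /rho ler_pM2l ?powR_gt0// /tailG lerB// ltW//.
  exact: G_ltK.
have P0 : 0 < (1 + t ^+ 2) `^ m by exact: powR_gt0.
set C := PhiI t s1 + M * (s2 - s1).
suff: K <= C / (1 + t ^+ 2) `^ m + G t.
  by rewrite -lerBlDr ler_pdivlMr// mulrC -/(tailG t) -/(rho t) /C; lra.
have s1lt : s1 < s2 by rewrite e2 -[_^-1]mul1r ltr_pdivlMr// mulrC.
have N0 : 0 < 1 - t * s1 by rewrite subr_gt0.
(* Every [y] past this threshold is the rotated slope of some [z] between [s1] and [s2], so
   [PhiI_bounds] on the segment from [s1] to [z] bounds [G y]. The first entry of the maximum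
   ensures [s1 <= z], the second [0 < y]. *)
apply: (@K_le (Num.max ((s1 + t) / (1 - t * s1)) t)) => y; rewrite ge_max => /andP[y1 y2].
have y0 : 0 < y by apply: lt_le_trans y2.
have n1 : 0 < 1 + t * y by rewrite ltr_pwDl// mulr_ge0// ltW.
pose z := (y - t) / (1 + t * y).
have tz : t * z < 1.
  rewrite /z mulrA ltr_pdivrMr// mul1r mulrBr.
  by have tt : 0 < t * t; [rewrite mulr_gt0|lra].
have ez : (z + t) / (1 - t * z) = y.
  have nn : 1 + t * y != 0 by rewrite gt_eqF.
  have nt : 1 + t * t != 0 by rewrite -expr2 gt_eqF.
  have n3 : 1 - t * z = (1 + t * t) / (1 + t * y) by rewrite /z; field.
  have n4 : z + t = y * ((1 + t * t) / (1 + t * y)) by rewrite /z; field.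
  by rewrite n3 n4 mulfK// mulf_neq0// invr_neq0.
have s1z : s1 <= z.
  rewrite /z ler_pdivlMr//; move: y1; rewrite ler_pdivrMr//; lra.
have zs2 : z < s2 by rewrite e2 -[_^-1]mul1r ltr_pdivlMr// mulrC.
have hM' s : s1 <= s <= z -> phi t s <= M.
  by move=> /andP[a b]; apply: hM; rewrite a (le_trans b)// ltW.
have /andP[_] := PhiI_bounds s1z t0 tz hM'.
rewrite {1}/PhiI ez -lerBlDr ler_pdivlMr// /C => h.
have : M * (z - s1) <= M * (s2 - s1) by rewrite ler_wpM2l// lerD2r ltW.
by move: h; lra.
Qed.

End Profile.

(** * Continuous extensions and the chain rule inequality *)

Section Continuity.
Variable R : realType.
Local Notation mu := (@lebesgue_measure R).
Implicit Types (f g k z : R -> R) (a b x y : R).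

Lemma continuous_max0_powR (r : R) : 0 < r ->
  continuous (fun v : R => (Num.max 0 v) `^ r).
Proof.
move=> r0 v; apply/cvgrPdist_lt => e e0; case: (ltgtP v 0) => v0.
- near=> w; rewrite !max_l ?subrr ?normr0// ?(ltW v0)//.
  by apply/ltW; near: w; exact: lt_nbhsl.
- have /cvgrPdist_lt/(_ e e0) h := is_derive1_continuous (is_derive1_powR r v0).
  near=> w; rewrite !max_r ?(ltW v0)//; last by apply/ltW; near: w; exact: lt_nbhsr.
  by near: w.
- rewrite v0; pose d := e `^ r^-1; have d0 : 0 < d by exact: powR_gt0.
  near=> w; rewrite ?maxxx powR0 ?gt_eqF// sub0r normrN ger0_norm ?powR_ge0//.
  have -> : e = d `^ r by rewrite /d -powRrM mulVf ?gt_eqF// powRr1 ?ltW.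
  apply: gt0_ltr_powR => //; rewrite ?nnegrE ?le_max ?lexx ?(ltW d0)//.
  rewrite gt_max d0 (le_lt_trans (ler_norm w))//.
Unshelve. all: by end_near. Qed.

Definition clamp x := Num.max 0 (Num.min x 1).

Lemma clamp_id x : 0 <= x <= 1 -> clamp x = x.
Proof. by move=> /andP[x0 x1]; rewrite /clamp min_l// max_r. Qed.

Lemma clamp_itv x : 0 <= clamp x <= 1.
Proof. by rewrite /clamp le_max lexx ge_max ler01 ge_min lexx orbT. Qed.

Lemma continuous_clamp : continuous clamp.
Proof.
move=> x; apply: (@continuous_max R R (cst 0) (fun v => Num.min v 1)).
  exact: cvg_cst.
by apply: (@continuous_min R R id (cst 1)); [exact: cvg_id|exact: cvg_cst].
Qed.

Lemma continuous_comp_clamp f : {within `[0, 1], continuous f} ->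
  continuous (fun x => f (clamp x)).
Proof.
move=> /subspace_continuousP cf x.
have c01 : `[0, 1]%classic (clamp x) by rewrite /= in_itv/= clamp_itv.
have := cf _ c01; rewrite /= /from_subspace => h.
apply: (cvg_comp _ _ _ h).
move=> A /= /(@continuous_clamp x) hA.
have {}hA : nbhs x (fun y => `[0, 1]%classic (clamp y) -> A (clamp y)) := hA.
apply: filterS hA => y hy; apply: hy.
by rewrite /= in_itv/= clamp_itv.
Qed.

Lemma integrableM_continuous g k a b : mu.-integrable `[a, b] (EFin \o g) ->
  continuous k -> mu.-integrable `[a, b] (EFin \o (fun x => g x * k x)).
Proof.
move=> gi ck; case: (leP a b) => ab; last first.
  by rewrite set_itv_ge ?bnd_simp -?ltNge//; exact: integrable_set0.
have -> : EFin \o (fun x => g x * k x) =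
    ((EFin \o g) \* (EFin \o k))%E.
  by apply/funext => x /=; rewrite EFinM.
apply: integrableMl => //.
  apply: subspace_continuous_measurable_fun => //; exact: continuous_subspaceT.
have [|c _ h] := @EVT_max R (fun x => `|k x|) a b ab.
  apply: continuous_subspaceT => x; apply: continuous_comp (ck x) _.
  exact: norm_continuous.
exists `|k c|; split; first exact: num_real.
by move=> M Mk x /= xab; apply: le_trans (h _ xab) (ltW Mk).
Qed.

(** Continuous induction: the supremum of the points where [D] is at least [D a] is again such a
    point by the local hypothesis there, and the same hypothesis pushes it further right unless it
    is [b]. *)
Lemma locally_nondecreasing_le (D : R -> R) a b : a <= b ->
  (forall x, a <= x <= b -> exists2 d, 0 < d &
    forall x1 x2, a <= x1 -> x1 <= x2 -> x2 <= b ->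
      `|x - x1| < d -> `|x - x2| < d -> D x1 <= D x2) ->
  D a <= D b.
Proof.
move=> ab h; pose S := [set x | a <= x <= b /\ D a <= D x].
have Sa : S a by split; rewrite ?lexx.
have hS : has_sup S.
  by split; [exists a|exists b => x [/andP[]]].
set s := sup S; have as_ : a <= s by apply: sup_upper_bound.
have sb : s <= b by apply: sup_le_ub; [exists a|move=> x [/andP[]]].
have sab : a <= s <= b by rewrite as_ sb.
have [d d0 hd] := h s sab.
have ss : `|s - s| < d by rewrite subrr normr0.
have Ss : D a <= D s.
  have [x [/andP[ax xb] Dx] sx] := sup_adherent d0 hS.
  have xs : x <= s by apply: sup_upper_bound => //; split => //; rewrite ax.
  apply: le_trans Dx _; apply: hd => //.
  by rewrite ger0_norm ?subr_ge0//; move: sx; rewrite -/s; lra.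
move: sb; rewrite le_eqVlt => /predU1P[<-//|sb].
pose y := Num.min (s + d / 2) b.
have sy : s < y by rewrite /y lt_min sb andbT ltrDl divr_gt0.
have yb : y <= b by rewrite /y ge_min lexx orbT.
have yd : y <= s + d / 2 by rewrite /y ge_min lexx.
have Sy : S y.
  split; first by rewrite yb (le_trans as_)// ltW.
  apply: le_trans Ss _; apply: hd => //; first exact: ltW.
  by rewrite ltr0_norm ?subr_lt0//; move: d0 yd; lra.
by have := sup_upper_bound hS Sy; rewrite -/s leNgt sy.
Qed.

(* Chain rule inequality for an absolutely continuous inner function; only
   the mean value inequality is required of the outer one. *)
Lemma chain_upper_bound g z (F f : R -> R) a b (B : R) : a <= b ->
  mu.-integrable `[a, b] (EFin \o g) -> continuous z -> continuous f ->
  (forall s, 0 <= f s) ->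
  (forall x y, a <= x -> x <= y -> y <= b ->
     z y - z x = \int[mu]_(t in `[x, y]) g t) ->
  (forall x, a <= x <= b -> z x <= B) ->
  (forall s1 s2 M, s1 <= s2 -> s2 <= B ->
     (forall s, s1 <= s <= s2 -> f s <= M) -> `|F s2 - F s1| <= M * (s2 - s1)) ->
  F (z b) - F (z a) <= \int[mu]_(x in `[a, b]) (`|g x| * f (z x)).
Proof.
move=> ab gi cz cf f0 zg zB HF.
have ni : mu.-integrable `[a, b] (EFin \o (fun x => `|g x|)).
  exact: integrable_norm gi.
have cfz : continuous (fun x => f (z x)).
  by move=> x; apply: (continuous_comp (cz x)); exact: cf.
have sub x y : a <= x -> y <= b -> `[x, y] `<=` `[a, b].
  by move=> ax yb; apply: subset_itvScc; rewrite bnd_simp.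
have main e : 0 < e ->
    F (z b) - F (z a) <= \int[mu]_(x in `[a, b]) (`|g x| * (f (z x) + e)).
  move=> e0; have cfe : continuous (fun x => f (z x) + e).
    by move=> x; apply: cvgD; [exact: cfz|exact: cvg_cst].
  have hi := integrableM_continuous ni cfe.
  (* The added [e] absorbs the oscillation of [f]: near a point [x] one has
     [f <= f (z x) + e / 2 <= f (z t) + e], so the increment of [F] along [z] is dominated by that
     of the integral, and [D] is locally nondecreasing. *)
  pose D x := \int[mu]_(t in `[a, x]) (`|g t| * (f (z t) + e)) - F (z x).
  suff : D a <= D b by rewrite /D Rintegral_segment0; lra.
  apply: locally_nondecreasing_le => // x xab.
  have e2 : 0 < e / 2 by rewrite divr_gt0.
  have /cvgrPdist_lt/(_ _ e2)/nbhs_ballP[d1 /= d10 h1] := cf (z x).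
  have /cvgrPdist_lt/(_ _ d10)/nbhs_ballP[d2 /= d20 h2] := cz x.
  exists d2 => // x1 x2 ax1 x12 x2b xx1 xx2.
  have s12 := sub _ _ ax1 x2b.
  have nis : mu.-integrable `[x1, x2] (EFin \o (fun x => `|g x|)).
    exact: integrableS ni.
  have gis : mu.-integrable `[x1, x2] (EFin \o g) by exact: integrableS gi.
  have his : mu.-integrable `[x1, x2] (EFin \o (fun x => `|g x| * (f (z x) + e))).
    exact: integrableS hi.
  have close1 y : x1 <= y <= x2 -> `|z x - z y| < d1.
    move=> /andP[x1y yx2]; apply: h2; rewrite /ball/=.
    by move: xx1 xx2; rewrite !ltr_norml; lra.
  have zle : `|z x2 - z x1| <= \int[mu]_(t in `[x1, x2]) `|g t|.
    by rewrite zg//; apply: le_normr_Rintegral.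
  set M := f (z x) + e / 2.
  have M0 : 0 <= M by rewrite addr_ge0// ltW.
  have step : `|F (z x2) - F (z x1)| <= M * `|z x2 - z x1|.
    have hM s : `|z x - s| < d1 -> f s <= M.
      by move=> /h1 /=; rewrite ltr_norml /M; lra.
    have c1 := close1 x1; have c2 := close1 x2; rewrite !lexx x12 in c1 c2.
    have {}c1 := c1 erefl; have {}c2 := c2 erefl.
    have x1ab : a <= x1 <= b by rewrite ax1 (le_trans x12).
    have x2ab : a <= x2 <= b by rewrite x2b (le_trans ax1).
    have [z12|z21] := leP (z x1) (z x2).
      rewrite [X in M * X]ger0_norm ?subr_ge0//; apply: HF => //; first exact: zB.
      move=> s /andP[s1 s2]; apply: hM; move: c1 c2; rewrite !ltr_norml; lra.
    rewrite distrC [X in M * X]distrC [X in M * X]ger0_norm ?subr_ge0 ?(ltW z21)//.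
    apply: HF; [exact: ltW|exact: zB|].
    by move=> s /andP[s1 s2]; apply: hM; move: c1 c2; rewrite !ltr_norml; lra.
  have bound : M * \int[mu]_(t in `[x1, x2]) `|g t| <=
      \int[mu]_(t in `[x1, x2]) (`|g t| * (f (z t) + e)).
    rewrite -RintegralZl//; apply: le_Rintegral => //.
      have := integrableM_continuous nis (@cst_continuous R R M).
      by apply: eq_integrable => // t _ /=; rewrite mulrC.
    move=> t /=; rewrite in_itv/= => ht; rewrite mulrC ler_wpM2l//.
    by have := h1 _ (close1 _ ht); rewrite /= ltr_norml /M; lra.
  have := @Rintegral_segment_cat R (fun t => `|g t| * (f (z t) + e)) a x1 x2 ax1 x12.
  move=> /(_ _)/wrap[|ecat]; first by apply: integrableS hi => //; exact: sub.
  have := le_trans step (ler_wpM2l M0 zle).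
  have := ler_norm (F (z x2) - F (z x1)).
  by move: bound; rewrite /D ecat; lra.
set I := \int[mu]_(x in `[a, b]) `|g x|.
have I0 : 0 <= I by apply: Rintegral_ge0 => x _.
apply/ler_addgt0Pr => e e0.
(* The error made by [main] is its parameter times [I]; dividing by [I + 1] keeps it below [e] even
   when [I = 0]. *)
have e1 : 0 < e / (I + 1) by rewrite divr_gt0// ltr_pwDr.
apply: le_trans (main _ e1) _.
have ci := integrableM_continuous ni cfz.
have cc := integrableM_continuous ni (@cst_continuous R R (e / (I + 1))).
rewrite (@eq_Rintegral _ _ _ mu _ (fun x => `|g x| * f (z x) + `|g x| * (e / (I + 1)))); last first.
  by move=> x _; rewrite mulrDr.
rewrite RintegralD// RintegralZr// lerD2l -/I mulrCA -[leRHS]mulr1 ler_pM2l//.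
by rewrite ler_pdivrMr ?mul1r ?lerDl// ltr_pwDr.
Qed.

Lemma chain_norm_bound g z (F f : R -> R) a b (B : R) : a <= b ->
  mu.-integrable `[a, b] (EFin \o g) -> continuous z -> continuous f ->
  (forall s, 0 <= f s) ->
  (forall x y, a <= x -> x <= y -> y <= b ->
     z y - z x = \int[mu]_(t in `[x, y]) g t) ->
  (forall x, a <= x <= b -> z x <= B) ->
  (forall s1 s2 M, s1 <= s2 -> s2 <= B ->
     (forall s, s1 <= s <= s2 -> f s <= M) -> `|F s2 - F s1| <= M * (s2 - s1)) ->
  `|F (z b) - F (z a)| <= \int[mu]_(x in `[a, b]) (`|g x| * f (z x)).
Proof.
move=> ab gi cz cf f0 zg zB HF; rewrite ler_norml; apply/andP; split; last first.
  exact: (chain_upper_bound ab gi cz cf f0 zg zB HF).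
rewrite lerNl opprB.
have := @chain_upper_bound g z (fun s => - F s) f a b B ab gi cz cf f0 zg zB.
move=> /(_ _)/wrap[s1 s2 M s12 s2B hM|]; last by rewrite opprK addrC.
have -> : - F s2 - - F s1 = - (F s2 - F s1) by ring.
by rewrite normrN; exact: HF.
Qed.

End Continuity.

(** * Changing a nonnegative integrand on a null set without measurability *)

Section NonmeasurableIntegral.
Variable R : realType.
Local Notation mu := (@lebesgue_measure R).
Import HBNNSimple.
Local Open Scope ereal_scope.

(* [f1] and [f2] need not be measurable: the integral of a nonnegative function
   is a supremum over the simple functions below it. *)
Lemma ge0_le_integral_off_null (D N : set (measurableTypeR R))
    (f1 f2 : measurableTypeR R -> \bar R) :
  measurable D -> measurable N -> mu N = 0 ->
  (forall x, D x -> 0 <= f1 x) -> (forall x, D x -> 0 <= f2 x) ->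
  (forall x, D x -> ~ N x -> f1 x <= f2 x) ->
  \int[mu]_(x in D) f1 x <= \int[mu]_(x in D) f2 x.
Proof.
move=> mD mN N0 f10 f20 f12; rewrite !(integral_mkcond D).
have h10 x : 0 <= (f1 \_ D) x by apply: erestrict_ge0.
have h20 x : 0 <= (f2 \_ D) x by apply: erestrict_ge0.
rewrite ge0_integralTE//; apply: ge_ereal_sup => _ [h /= hle <-].
rewrite -integralT_nnsfun.
(* A simple function below [f1] is cut off to 0 on [N]: its integral does not change, and it then
   lies below [f2] everywhere. *)
have mA : measurable ([set: R] `\` N) by apply: measurableD.
rewrite (@ge0_negligible_integral _ _ _ mu setT N)//; last 2 first.
  exact/measurable_EFinP.
  by move=> x _; rewrite lee_fin; exact: fun_ge0.
rewrite integral_nnsfun// ge0_integralTE//.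
apply: ereal_sup_ubound; exists (proj_nnsfun h mA); last by rewrite mrestrict.
move=> x; have -> : proj_nnsfun h mA x = (h \_ (setT `\` N)) x by rewrite mrestrict.
rewrite patchE; case: ifPn => [|_]; last exact: h20.
rewrite inE => -[_ Nx]; apply: le_trans (hle x) _.
rewrite !patchE; case: ifPn => //; rewrite inE => Dx; exact: f12.
Qed.

Lemma ge0_eq_integral_off_null (D N : set (measurableTypeR R))
    (f1 f2 : measurableTypeR R -> \bar R) :
  measurable D -> measurable N -> mu N = 0 ->
  (forall x, D x -> 0 <= f1 x) -> (forall x, D x -> 0 <= f2 x) ->
  (forall x, D x -> ~ N x -> f1 x = f2 x) ->
  \int[mu]_(x in D) f1 x = \int[mu]_(x in D) f2 x.
Proof.
move=> mD mN N0 f10 f20 f12; apply/le_anti/andP; split;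
  by apply: (ge0_le_integral_off_null mD mN N0) => // x Dx Nx; rewrite f12.
Qed.

End NonmeasurableIntegral.

(** * Energy in terms of the slope, and the lower bound from Young's inequality *)

Section Energy.
Variables (R : realType) (p : R).
Hypothesis p_gt1 : 1 < p.
Local Notation mu := (@lebesgue_measure R).
Implicit Types (u z g : R -> R) (a b x y t h : R).

Definition mexp := (1 - p^-1) / 2.
Local Notation m := mexp.

Lemma p_gt0 : 0 < p. Proof. by apply: lt_trans p_gt1. Qed.

Lemma mexp_gt0 : 0 < m.
Proof. by rewrite divr_gt0// subr_gt0 invf_lt1 ?p_gt0. Qed.

Lemma mexp_lt12 : m < 1 / 2.
Proof. by rewrite ltr_pM2r ?invr_gt0// ltrBlDr ltrDl invr_gt0 p_gt0. Qed.

Lemma mexp2 : 2 * m = 1 - p^-1.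
Proof. by rewrite /mexp; field; rewrite gt_eqF// p_gt0. Qed.

Lemma mulp_mexp2 : p * (2 * m) = p - 1.
Proof. by rewrite mexp2 mulrBr mulr1 divff// gt_eqF// p_gt0. Qed.

(* [z] is a continuous extension of [u'] to the line, and [g] is [u''] on [0, 1]. *)
Record slope_data u z g : Prop := SlopeData {
  slope_continuous : continuous z ;
  slope_integrable : mu.-integrable `[0, 1] (EFin \o g) ;
  slope_integrable_powR : mu.-integrable `[0, 1] (EFin \o (fun x => `|g x| `^ p)) ;
  slope_sub : forall x y, 0 <= x -> x <= y -> y <= 1 ->
    z y - z x = \int[mu]_(s in `[x, y]) g s ;
  slope_primitive : forall x y, 0 <= x -> x <= y -> y <= 1 ->
    u y - u x = \int[mu]_(s in `[x, y]) z s }.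

Lemma W2p_slope u : W2p p u -> exists z g, slope_data u z g.
Proof.
move=> [c [g [mg [gi [gp uE]]]]].
have gi' : mu.-integrable `[0, 1] (EFin \o g) := gi.
pose F x := \int[mu]_(s in `[0, x]) g s.
have cF : {within `[0, 1], continuous F}.
  exact: parameterized_integral_continuous.
(* Clamping makes the slope constant outside the unit interval, hence continuous on the whole
   line. *)
pose z x := c + F (clamp x).
have cz : continuous z.
  by move=> x; apply: cvgD; [exact: cvg_cst|exact: continuous_comp_clamp].
have zE x : 0 <= x <= 1 -> z x = c + F x by move=> h; rewrite /z clamp_id.
have ziI a b : mu.-integrable `[a, b] (EFin \o z).
  by apply: continuous_segment_integrable; exact: continuous_subspaceT.
have sub x y : 0 <= x -> y <= 1 -> `[x, y] `<=` `[0, 1].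
  by move=> ax yb; apply: subset_itvScc; rewrite bnd_simp.
exists z, g; split => //.
- apply/integrableP; split.
    apply/measurable_EFinP.
    apply: (@measurableT_comp _ _ _ _ _ _ (@powR R ^~ p)) => //.
    exact: measurableT_comp.
  under eq_integral do rewrite /= ger0_norm ?powR_ge0//.
  exact: gp.
- move=> x y x0 xy y1; have x1 := le_trans xy y1; have y0 := le_trans x0 xy.
  rewrite !zE ?x0 ?x1 ?y0 ?y1// /F (@Rintegral_segment_cat R g 0 x y)//; first by ring.
  by apply: integrableS gi' => //; exact: sub.
- have uz x : 0 <= x <= 1 -> u x = u 0 + \int[mu]_(s in `[0, x]) z s.
    move=> /andP[x0 x1]; rewrite uE; last by rewrite x0.
    apply: (congr1 (+%R (u 0))); apply: eq_Rintegral => s.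
    rewrite inE/= in_itv/= => /andP[s0 sx].
    by rewrite zE ?s0 ?(le_trans sx).
  move=> x y x0 xy y1; have x1 := le_trans xy y1; have y0 := le_trans x0 xy.
  have hx : 0 <= x <= 1 by rewrite x0.
  have hy : 0 <= y <= 1 by rewrite y0.
  rewrite (uz _ hy) (uz _ hx) (Rintegral_segment_cat x0 xy (ziI 0 y)).
  by rewrite opprD addrACA subrr add0r addrAC subrr add0r.
Qed.

Lemma slope_W2p u z g : slope_data u z g -> W2p p u.
Proof.
move=> [cz gi gp zg uz]; exists (z 0), g.
split; first by apply/measurable_EFinP; exact: measurable_int gi.
split => //; split.
  move/integrableP : gp => [_].
  by under eq_integral do rewrite /= ger0_norm ?powR_ge0//.
move=> x /andP[x0 x1]; rewrite -(subrK (u 0) (u x)) uz// addrC.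
apply: (congr1 (+%R (u 0))); apply: eq_Rintegral => s; rewrite inE/= in_itv/= => /andP[s0 sx].
by rewrite -zg ?(le_trans sx)//; ring.
Qed.

(** The absolute derivative of [G m] along the slope [z], with [g] for the derivative of [z]. *)
Definition speed g z x := `|g x| * dG m (z x).

Lemma speed_ge0 g z x : 0 <= speed g z x.
Proof. by rewrite mulr_ge0// ltW// dG_gt0. Qed.

Lemma continuous_dG_comp z : continuous z -> continuous (fun x => dG m (z x)).
Proof. by move=> cz x; apply: (continuous_comp (cz x)); exact: continuous_dG. Qed.

Lemma slope_derive u z g x : slope_data u z g -> 0 < x < 1 -> is_derive x 1 u (z x).
Proof.
move=> [cz gi gp zg uz] /andP[x0 x1].
pose F (y : R) : R := \int[mu]_(s in `[0, y]) z s.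
have [dF eF] : derivable F x 1 /\ derive1 F x = z x.
  apply: (@continuous_FTC1_closed R z 0 x 1) => //; last exact: cz.
  by apply: continuous_segment_integrable; exact: continuous_subspaceT.
have d : is_derive x 1 F (z x).
  by apply: DeriveDef; [exact: dF|rewrite -derive1E; exact: eF].
have {dF eF} d2 : is_derive x 1 (fun y => u 0 + F y) (z x).
  have := is_derive1D (is_derive1_cst (u 0) x) d; rewrite add0r; exact.
have ne : {near x, (fun y => u 0 + F y) =1 u}.
  near=> y; have y0 : 0 <= y by apply/ltW; near: y; exact: lt_nbhsr.
  have y1 : y <= 1 by apply/ltW; near: y; exact: lt_nbhsl.
  by rewrite /F -uz//; ring.
exact: is_derive1_near_eq ne d2.
Unshelve. all: by end_near. Qed.

Lemma slope_ae_derive u z g : slope_data u z g ->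
  {ae mu, forall x, 0 < x < 1 -> is_derive x 1 z (g x)}.
Proof.
move=> [cz gi gp zg uz].
have li : locally_integrable [set: R] (g \_ `[0, 1]) by exact: integrable_locally.
have gi1 y : mu.-integrable `[0, y] (EFin \o (g \_ `[0, 1])).
  rewrite -restrict_EFin; apply/integrable_restrict => //=.
  by apply: integrableS gi => //; exact: measurableI.
have := @FTC1 R (g \_ `[0, 1]) (BLeft 0) gi1 li.
apply: filterS; first exact: (ae_filter_ringOfSetsType mu).
move=> x /= h /andP[x0 x1].
have [|dF eF] := h; first by rewrite lte_fin.
pose F (y : R) : R := \int[mu]_(s in `[0, y]) (g \_ `[0, 1]) s.
have gx : (g \_ `[0, 1]) x = g x.
  by rewrite patchE mem_set//= in_itv/= !ltW.
have d : is_derive x 1 F (g x).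
  by apply: DeriveDef; [exact: dF|rewrite -derive1E -gx; exact: eF].
have {dF eF} d2 : is_derive x 1 (fun y => z 0 + F y) (g x).
  have := is_derive1D (is_derive1_cst (z 0) x) d; rewrite add0r; exact.
have ne : {near x, (fun y => z 0 + F y) =1 z}.
  near=> y; have y0 : 0 <= y by apply/ltW; near: y; exact: lt_nbhsr.
  have y1 : y <= 1 by apply/ltW; near: y; exact: lt_nbhsl.
  have -> : F y = \int[mu]_(s in `[0, y]) g s.
    apply: eq_Rintegral => s; rewrite inE/= in_itv/= => /andP[s0 sy].
    by rewrite patchE mem_set//= in_itv/= s0 (le_trans sy).
  by rewrite -zg//; ring.
exact: is_derive1_near_eq ne d2.
Unshelve. all: by end_near. Qed.

Lemma integrable_speed_powR g z a b : continuous z ->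
  mu.-integrable `[a, b] (EFin \o g) ->
  mu.-integrable `[a, b] (EFin \o (fun x => `|g x| `^ p)) ->
  mu.-integrable `[a, b] (EFin \o (fun x => speed g z x `^ p)).
Proof.
move=> cz gi gp.
have si : mu.-integrable `[a, b] (EFin \o speed g z).
  apply: integrableM_continuous; first exact: integrable_norm gi.
  exact: continuous_dG_comp.
have ms : measurable_fun `[a, b] (speed g z).
  by apply/measurable_EFinP; exact: measurable_int si.
apply: le_integrable gp => //.
  by apply/measurable_EFinP; exact: (@measurableT_comp _ _ _ _ _ _ (@powR R ^~ p)).
move=> x _ /=; rewrite lee_fin ger0_norm ?powR_ge0// [leRHS]ger0_norm ?powR_ge0//.
apply: ge0_ler_powR; rewrite ?nnegrE ?speed_ge0// ?(ltW p_gt0)//.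
by rewrite /speed ler_piMr// dG_le1// mexp_gt0.
Qed.

(** Exponent count: (1 + m) p = (3p - 1) / 2, because 2 m p = p - 1. *)
Lemma curv_density (g0 z0 : R) :
  `|g0 / Num.sqrt (1 + z0 ^+ 2) ^+ 3| `^ p * Num.sqrt (1 + z0 ^+ 2) =
  (`|g0| * dG m z0) `^ p.
Proof.
have X0 : 0 < 1 + z0 ^+ 2 by exact: sq1_gt0.
set X := 1 + z0 ^+ 2 in X0 *.
have s0 : 0 < Num.sqrt X by rewrite sqrtr_gt0.
rewrite normrM normfV [X in _ / X]ger0_norm ?exprn_ge0 ?(ltW s0)//.
rewrite powRM ?invr_ge0 ?exprn_ge0 ?(ltW s0)// powRM ?powR_ge0//.
rewrite -mulrA; congr (_ * _).
rewrite /dG -/X -powRrM -powR12_sqrt ?(ltW X0)//.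
have -> : ((X `^ 2^-1) ^+ 3)^-1 = X `^ (- (3 / 2)).
  rewrite powRN; congr (_^-1).
  by rewrite -powR_mulrn ?powR_ge0// -powRrM; congr (_ `^ _); field.
rewrite -powRrM -powRD; last by rewrite (gt_eqF X0) implybT.
congr (_ `^ _); have e := mulp_mexp2.
have -> : (- 1 - m) * p = - p - (p * (2 * m)) / 2 by field.
by rewrite e; field.
Qed.

(** On the open interval [derive1 u] is [z], so the second derivative is [g] wherever [z] has
    derivative [g], that is almost everywhere. No measurability of [curv u] is available, hence the
    comparison off a null set. *)
Lemma Ep_slope u z g : slope_data u z g ->
  Ep p u = (\int[mu]_(x in `[0, 1]) (speed g z x `^ p))%:E.
Proof.
move=> sd; have [cz gi gp _ _] := sd.
have si := integrable_speed_powR cz gi gp.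
(* The endpoints join the exceptional set: [u] is arbitrary outside the unit interval, so its
   derivatives at 0 and 1 carry no information. *)
have [A [mA A0 sA]] : mu.-negligible
    (~` [set x : R | 0 < x < 1 -> is_derive x 1 z (g x)] `|` ([set 0] `|` [set 1])).
  apply: negligibleU; first exact: slope_ae_derive sd.
  by apply: negligibleU; apply/negligibleP => //; exact: lebesgue_measure_set1.
transitivity (\int[mu]_(x in `[0%R, 1%R]) (speed g z x `^ p)%:E)%E; last first.
  by rewrite /Rintegral fineK//; apply: integrable_fin_num.
rewrite /Ep; apply: (ge0_eq_integral_off_null _ mA A0) => //.
- exact: measurable_itv.
- by move=> x _; rewrite lee_fin powR_ge0.
move=> x; rewrite /I01 /= in_itv/= => /andP[x0 x1] NA.
have x01 : 0 < x < 1.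
  rewrite !lt_neqAle x0 x1 !andbT; apply/andP; split; apply/eqP => e; apply: NA; apply: sA.
    by right; left; rewrite e.
  by right; right; rewrite -e.
have dz : is_derive x 1 z (g x).
  by apply: contrapT => ndz; apply: NA; apply: sA; left => /(_ x01).
have du y : 0 < y < 1 -> derive1 u y = z y.
  by move=> /(slope_derive sd) d; rewrite derive1E; exact: derive_val.
have ddu : derive1 (derive1 u) x = g x.
  rewrite [LHS]derive1E -(@derive_val _ _ _ _ _ _ _ dz); apply: near_eq_derive.
  move/andP : x01 => [x00 x11]; near=> y; apply: du; apply/andP; split.
    by near: y; exact: lt_nbhsr.
  by near: y; exact: lt_nbhsl.
by rewrite /curv ddu du// curv_density.
Unshelve. all: by end_near. Qed.

Lemma powR_tangent (v : R) : 0 <= v -> v != 1 -> 1 + p * (v - 1) < v `^ p.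
Proof.
rewrite le_eqVlt => /predU1P[<- _|v0 v1].
  by rewrite powR0 ?gt_eqF ?p_gt0//; have := p_gt1; lra.
have pm1 : 0 < p - 1 by rewrite subr_gt0.
have d (s : R) : 0 < s -> is_derive s 1 (fun w : R => w `^ p) (p * s `^ (p - 1)).
  by move=> s0; exact: is_derive1_powR.
move: v1; rewrite neq_lt => /orP[v1|v1].
  have [|c /andP[vc c1] e] := @MVT_everywhere R (fun w : R => w `^ p)
      (fun s => p * s `^ (p - 1)) v 1 v1.
    by move=> x /andP[vx _]; apply: d; apply: lt_le_trans vx.
  have c0 := lt_trans v0 vc.
  have cp : c `^ (p - 1) < 1.
    have := @gt0_ltr_powR R (p - 1) pm1 c 1.
    by rewrite !nnegrE (ltW c0) ler01 powR1; apply.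
  have : p * c `^ (p - 1) * (1 - v) < p * (1 - v).
    by rewrite ltr_pM2r ?subr_gt0// gtr_pMr// p_gt0.
  by rewrite -e powR1; lra.
have [|c /andP[vc c1] e] := @MVT_everywhere R (fun w : R => w `^ p)
    (fun s => p * s `^ (p - 1)) 1 v v1.
  by move=> x /andP[vx _]; apply: d; apply: lt_le_trans vx.
have cp : 1 < c `^ (p - 1).
  have := @gt0_ltr_powR R (p - 1) pm1 1 c.
  by rewrite !nnegrE (ltW (lt_trans ltr01 vc)) ler01 powR1; apply.
have : p * (v - 1) < p * c `^ (p - 1) * (v - 1).
  by rewrite ltr_pM2r ?subr_gt0// ltr_pMr// p_gt0.
by rewrite -e powR1; lra.
Qed.

(** The tangent inequality at 1 for [W / B], scaled by [B ^ p]. Strictness off [W = B] is what makes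
    equality in the energy bound rigid. *)
Lemma young_tangent (W B : R) : 0 <= W -> 0 <= B -> W != B ->
  p * (B `^ (p - 1) * W) - (p - 1) * B `^ p < W `^ p.
Proof.
move=> W0; rewrite le_eqVlt => /predU1P[<- WB|B0 WB].
  rewrite !powR0 ?gt_eqF ?p_gt0 ?subr_gt0// mul0r !mulr0 subrr.
  by apply: powR_gt0; rewrite lt_neqAle eq_sym WB.
have v0 : 0 <= W / B by rewrite divr_ge0// ltW.
have v1 : W / B != 1.
  by apply: contra WB => /eqP e; rewrite -[W](divfK (lt0r_neq0 B0)) e mul1r.
have := powR_tangent v0 v1.
rewrite powRM ?invr_ge0 ?(ltW B0)//.
have Bp : 0 < B `^ p by exact: powR_gt0.
have -> : B^-1 `^ p = (B `^ p)^-1 by rewrite -powR_inv1 ?(ltW B0)// -powRrM mulN1r powRN.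
rewrite ltr_pdivlMr//; apply: le_lt_trans.
have -> : B `^ (p - 1) = B `^ p / B.
  by rewrite powRB ?powRr1 ?(ltW B0)// (gt_eqF B0) implybT.
rewrite le_eqVlt; apply/orP; left; apply/eqP; field.
by rewrite gt_eqF.
Qed.

Definition gap t x := Num.max 0 (1 - t * x).

Lemma gap_ge0 t x : 0 <= gap t x. Proof. by rewrite le_max lexx. Qed.

Lemma continuous_gap t z : continuous z -> continuous (fun x => gap t (z x)).
Proof.
move=> cz x; apply: (@continuous_max R R (cst 0) (fun x => 1 - t * z x)).
  exact: cvg_cst.
by apply: cvgB; [exact: cvg_cst|apply: cvgMr; exact: cz].
Qed.

Lemma continuous_gap_powR t z (r : R) : 0 < r -> continuous z ->
  continuous (fun x => gap t (z x) `^ r).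
Proof.
move=> r0 cz x.
have cl : continuous (fun x => 1 - t * z x).
  by move=> y; apply: cvgB; [exact: cvg_cst|apply: cvgMr; exact: cz].
apply: (@continuous_comp _ _ _ (fun x => 1 - t * z x)
  (fun v : R => (Num.max 0 v) `^ r)); first exact: cl.
exact: continuous_max0_powR.
Qed.

Lemma continuous_phi t z : continuous z -> continuous (fun x => phi m t (z x)).
Proof.
move=> cz x; apply: cvgM; first exact: continuous_dG_comp.
by apply: (continuous_gap_powR _ cz); rewrite mulr_gt0 ?mexp_gt0.
Qed.

(* The slack in Young's inequality with the weight [kap^p * gap t (z x)]. *)
Definition defect t (kap : R) g z x :=
  speed g z x `^ p - p * kap `^ (p - 1) * (`|g x| * phi m t (z x))
  + (p - 1) * kap `^ p * gap t (z x).

Lemma defectE t kap g z x : 0 < kap -> let B := kap * gap t (z x) `^ p^-1 in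
  defect t kap g z x = speed g z x `^ p
    - (p * (B `^ (p - 1) * speed g z x) - (p - 1) * B `^ p).
Proof.
move=> k0 B; have D0 := gap_ge0 t (z x).
have B1 : B `^ (p - 1) = kap `^ (p - 1) * gap t (z x) `^ (2 * m).
  rewrite /B powRM ?powR_ge0 ?(ltW k0)// -powRrM; congr (_ * _ `^ _).
  by rewrite mexp2; field; rewrite gt_eqF// p_gt0.
have B2 : B `^ p = kap `^ p * gap t (z x).
  rewrite /B powRM ?powR_ge0 ?(ltW k0)// -powRrM mulVf ?powRr1//.
  by rewrite gt_eqF// p_gt0.
by rewrite B1 B2 /defect /speed /phi -/(gap t (z x)); ring.
Qed.

Lemma defect_ge0 t kap g z x : 0 < kap -> 0 <= defect t kap g z x.
Proof.
move=> k0; rewrite defectE//; set B := kap * _.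
have B0 : 0 <= B by rewrite mulr_ge0 ?powR_ge0// ltW.
have [->|ne] := eqVneq (speed g z x) B; last first.
  by rewrite subr_ge0 ltW// young_tangent// speed_ge0.
rewrite (mulrC (B `^ _)) mulr_powRB1 ?p_gt0//.
rewrite le_eqVlt; apply/orP; left; apply/eqP; ring.
Qed.

Lemma defect_eq0 t kap g z x : 0 < kap -> defect t kap g z x = 0 ->
  speed g z x = kap * gap t (z x) `^ p^-1.
Proof.
move=> k0; rewrite defectE//; set B := kap * _ => e.
have B0 : 0 <= B by rewrite mulr_ge0 ?powR_ge0// ltW.
have [//|ne] := eqVneq (speed g z x) B.
by have := young_tangent (speed_ge0 g z x) B0 ne; rewrite -subr_gt0 e ltxx.
Qed.

Lemma integrable_mull (c : R) (f : R -> R) a b :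
  mu.-integrable `[a, b] (EFin \o f) ->
  mu.-integrable `[a, b] (EFin \o (fun x => c * f x)).
Proof.
move=> fi; have := integrableM_continuous fi (@cst_continuous R R c).
by apply: eq_integrable => // x _ /=; rewrite mulrC.
Qed.

Lemma Rintegral_segment_le (f : R -> R) a b x y : a <= x -> x <= y -> y <= b ->
  (forall s, 0 <= f s) -> mu.-integrable `[a, b] (EFin \o f) ->
  \int[mu]_(s in `[x, y]) f s <= \int[mu]_(s in `[a, b]) f s.
Proof.
move=> ax xy yb f0 fi.
have ge c d : 0 <= \int[mu]_(s in `[c, d]) f s by apply: Rintegral_ge0.
rewrite (@Rintegral_segment_cat R f a x b) ?(le_trans xy)//.
rewrite (@Rintegral_segment_cat R f x y b)//; last first.
  by apply: integrableS fi => //; apply: subset_itvScc; rewrite bnd_simp.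
by rewrite addrCA lerDl addr_ge0.
Qed.

(** The condition [t * z x <= 1] removes the truncation in [gap], so the last term depends on [z]
    only through its integral, the height climbed. *)
Lemma integral_defect t kap g z a b : a <= b -> continuous z ->
  mu.-integrable `[a, b] (EFin \o g) ->
  mu.-integrable `[a, b] (EFin \o (fun x => `|g x| `^ p)) ->
  (forall x, a <= x <= b -> t * z x <= 1) ->
  mu.-integrable `[a, b] (EFin \o defect t kap g z) /\
  \int[mu]_(x in `[a, b]) defect t kap g z x =
  \int[mu]_(x in `[a, b]) (speed g z x `^ p)
  - p * kap `^ (p - 1) * \int[mu]_(x in `[a, b]) (`|g x| * phi m t (z x))
  + (p - 1) * kap `^ p * ((b - a) - t * \int[mu]_(x in `[a, b]) z x).
Proof.
move=> ab cz gi gp tz1.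
have i1 := integrable_speed_powR cz gi gp.
have i2 : mu.-integrable `[a, b] (EFin \o (fun x => `|g x| * phi m t (z x))).
  by apply: integrableM_continuous; [exact: integrable_norm gi|exact: continuous_phi].
have i2' := integrable_mull (p * kap `^ (p - 1)) i2.
have ic (f : R -> R) : continuous f -> mu.-integrable `[a, b] (EFin \o f).
  by move=> cf; apply: continuous_segment_integrable; exact: continuous_subspaceT.
have i3 : mu.-integrable `[a, b] (EFin \o (fun x => gap t (z x))).
  by apply: ic; exact: continuous_gap.
have i3' := integrable_mull ((p - 1) * kap `^ p) i3.
have i12 : mu.-integrable `[a, b] (EFin \o (fun x =>
    speed g z x `^ p - p * kap `^ (p - 1) * (`|g x| * phi m t (z x)))).
  by apply: eq_integrable (integrableB _ i1 i2') => // x _ /=; rewrite EFinB.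
split.
  by apply: eq_integrable (integrableD _ i12 i3') => // x _ /=; rewrite EFinD.
rewrite RintegralD// RintegralB// !RintegralZl//; congr (_ + _ * _).
have iz := ic _ cz.
rewrite (@eq_Rintegral _ _ _ mu _ (fun x => 1 - t * z x)); last first.
  move=> x; rewrite inE/= in_itv/= => /tz1 h; rewrite /gap max_r//.
  by rewrite subr_ge0.
rewrite RintegralB//; last 2 first.
- by apply: ic => x; exact: cvg_cst.
- exact: integrable_mull.
by rewrite RintegralZl// Rintegral_segment_cst// mul1r.
Qed.

(** Along the segment [Phi m t (z x)] takes the value [rho m t] where the slope is [t^-1] and 0
    where it vanishes. The chain inequality bounds the difference in either order of the two
    points. *)
Lemma rho_le_integral_phi t g z a b : 0 < t -> a <= b -> continuous z ->
  mu.-integrable `[a, b] (EFin \o g) ->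
  (forall x y, a <= x -> x <= y -> y <= b ->
     z y - z x = \int[mu]_(s in `[x, y]) g s) ->
  (forall x, a <= x <= b -> t * z x <= 1) ->
  (exists2 x, a <= x <= b & t * z x = 1) -> (exists2 x, a <= x <= b & z x = 0) ->
  rho m t <= \int[mu]_(x in `[a, b]) (`|g x| * phi m t (z x)).
Proof.
move=> t0 ab cz gi zg tz1 [x /andP[ax xb] zx] [y /andP[ay yb] zy].
have zxE : z x = t^-1 by rewrite -[LHS](mulKf (lt0r_neq0 t0)) zx mulr1.
have i2 : mu.-integrable `[a, b] (EFin \o (fun x => `|g x| * phi m t (z x))).
  by apply: integrableM_continuous; [exact: integrable_norm gi|exact: continuous_phi].
have n0 s : 0 <= `|g s| * phi m t (z s) by rewrite mulr_ge0 ?phi_ge0.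
have key c d : a <= c -> c <= d -> d <= b -> `|Phi m t (z d) - Phi m t (z c)| <=
    \int[mu]_(s in `[a, b]) (`|g s| * phi m t (z s)).
  move=> ac cd db; apply: le_trans (Rintegral_segment_le ac cd db n0 i2).
  have gi' : mu.-integrable `[c, d] (EFin \o g).
    by apply: integrableS gi => //; apply: subset_itvScc; rewrite bnd_simp.
  apply: (@chain_norm_bound R g z (Phi m t) (phi m t) c d t^-1) => //.
  - by have := @continuous_phi t id; apply => s; exact: cvg_id.
  - by move=> s; exact: phi_ge0.
  - by move=> v w cv vw wd; apply: zg => //; [exact: le_trans cv|exact: le_trans wd _].
  - move=> v /andP[cv vd]; rewrite -[_^-1]mul1r ler_pdivlMr// mulrC; apply: tz1.
    by rewrite (le_trans ac)// (le_trans vd).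
  - move=> s1 s2 M s12 s2t; apply: Phi_bounds => //; rewrite ?mexp_gt0 ?mexp_lt12//.
    by rewrite mulrC -ler_pdivlMr// mul1r.
have e : rho m t = Phi m t (z x) - Phi m t (z y).
  by rewrite zxE zy Phi0 Phi_top// subr0.
rewrite e; have [xy|yx] := leP x y; last first.
  by apply: le_trans (ler_norm _) (key _ _ ay (ltW yx) xb).
by apply: le_trans (ler_norm _) _; rewrite distrC; exact: key.
Qed.

(** The integral of the defect is kept on the left, since its vanishing is the equality case. *)
Lemma side_bound t kap g z a b : 0 < t -> 0 < kap -> a <= b -> continuous z ->
  mu.-integrable `[a, b] (EFin \o g) ->
  mu.-integrable `[a, b] (EFin \o (fun x => `|g x| `^ p)) ->
  (forall x y, a <= x -> x <= y -> y <= b ->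
     z y - z x = \int[mu]_(s in `[x, y]) g s) ->
  (forall x, a <= x <= b -> t * z x <= 1) ->
  (exists2 x, a <= x <= b & t * z x = 1) -> (exists2 x, a <= x <= b & z x = 0) ->
  p * kap `^ (p - 1) * rho m t
  - (p - 1) * kap `^ p * ((b - a) - t * \int[mu]_(x in `[a, b]) z x)
  + \int[mu]_(x in `[a, b]) defect t kap g z x
  <= \int[mu]_(x in `[a, b]) (speed g z x `^ p).
Proof.
move=> t0 k0 ab cz gi gp zg tz1 ex1 ex0.
have [_ ->] := integral_defect kap ab cz gi gp tz1.
have := rho_le_integral_phi t0 ab cz gi zg tz1 ex1 ex0.
have c0 : 0 < p * kap `^ (p - 1) by rewrite mulr_gt0 ?p_gt0 ?powR_gt0.
rewrite -(ler_pM2l c0); lra.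
Qed.

Lemma exists_positive_max z a b : a <= b -> continuous z ->
  0 < \int[mu]_(x in `[a, b]) z x ->
  exists2 t, 0 < t & (forall x, a <= x <= b -> t * z x <= 1) /\
                     (exists2 x, a <= x <= b & t * z x = 1).
Proof.
move=> ab cz I0.
have [|c] := @EVT_max R z a b ab; first exact: continuous_subspaceT.
rewrite in_itv/= => cab cmax.
have zc : 0 < z c.
  rewrite ltNge; apply/negP => zc; move: I0; rewrite ltNge => /negP; apply.
  have -> : 0 = \int[mu]_(x in `[a, b]) (0 : R).
    by rewrite Rintegral_segment_cst// mul0r.
  apply: le_Rintegral => //.
  - by apply: continuous_segment_integrable; exact: continuous_subspaceT.
  - by apply: continuous_segment_integrable; apply: continuous_subspaceT => x; exact: cvg_cst.
  - by move=> x /= xab; apply: le_trans (cmax _ xab) zc.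
exists (z c)^-1; first by rewrite invr_gt0.
split=> [x xab|]; last by exists c => //; rewrite mulVf// gt_eqF.
by rewrite mulrC ler_pdivrMr// mul1r; apply: cmax; rewrite in_itv.
Qed.

(** [side_bound] on both sides of [xm], with the reciprocals of the largest slopes of [u] and of
    [- u] as [t1] and [t2]. The height [u xm] enters with a positive coefficient and may be lowered
    to [h]. Only the left defect is retained, as uniqueness is settled on the left half. *)
Lemma energy_bound u z g (xm h kap : R) : slope_data u z g -> u 0 = 0 -> u 1 = 0 ->
  0 < xm < 1 -> z xm = 0 -> 0 < h -> h <= u xm -> 0 < kap ->
  exists t1 t2, [/\ 0 < t1, 0 < t2, forall x, 0 <= x <= xm -> t1 * z x <= 1 &
    p * kap `^ (p - 1) * (rho m t1 + rho m t2)
    - (p - 1) * kap `^ p * (1 - h * (t1 + t2))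
    + \int[mu]_(x in `[0, xm]) defect t1 kap g z x
    <= \int[mu]_(x in `[0, 1]) (speed g z x `^ p)].
Proof.
move=> [cz gi gp zg uz] u0 u1 /andP[x0 x1] zxm h0 hu k0.
have [x0' x1'] := (ltW x0, ltW x1).
have subL : `[0, xm] `<=` `[0, 1] by apply: subset_itvScc; rewrite bnd_simp.
have subR : `[xm, 1] `<=` `[0, 1] by apply: subset_itvScc; rewrite bnd_simp.
have IL : \int[mu]_(x in `[0, xm]) z x = u xm by rewrite -uz// u0 subr0.
have cNz : continuous (fun x => - z x) by move=> x; apply: cvgN; exact: cz.
have iz a b : mu.-integrable `[a, b] (EFin \o z).
  by apply: continuous_segment_integrable; exact: continuous_subspaceT.
have IR : \int[mu]_(x in `[xm, 1]) (- z x) = u xm.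
  rewrite (@eq_Rintegral _ _ _ mu _ (fun x => (- 1) * z x)); last first.
    by move=> x _; rewrite mulN1r.
  by rewrite RintegralZl// -uz// u1; ring.
have [|t1 t10 [t1z ex1]] := @exists_positive_max z 0 xm x0' cz.
  by rewrite IL; exact: lt_le_trans hu.
have [|t2 t20 [t2z ex2]] := @exists_positive_max (fun x => - z x) xm 1 x1' cNz.
  by rewrite IR; exact: lt_le_trans hu.
exists t1, t2; split => //.
have giL : mu.-integrable `[0, xm] (EFin \o g) by exact: integrableS gi.
have gpL : mu.-integrable `[0, xm] (EFin \o (fun x => `|g x| `^ p)).
  exact: integrableS gp.
have giR : mu.-integrable `[xm, 1] (EFin \o g) by exact: integrableS gi.
have gNiR : mu.-integrable `[xm, 1] (EFin \o (fun x => - g x)).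
  by have := integrable_mull (- 1) giR; apply: eq_integrable => // x _ /=; rewrite mulN1r.
have gpR : mu.-integrable `[xm, 1] (EFin \o (fun x => `|- g x| `^ p)).
  have : mu.-integrable `[xm, 1] (EFin \o (fun x => `|g x| `^ p)) by exact: integrableS gp.
  by apply: eq_integrable => // x _ /=; rewrite normrN.
have L : p * kap `^ (p - 1) * rho m t1 - (p - 1) * kap `^ p * (xm - 0 - t1 * u xm)
    + \int[mu]_(x in `[0, xm]) defect t1 kap g z x <=
    \int[mu]_(x in `[0, xm]) (speed g z x `^ p).
  rewrite -IL; apply: side_bound => //.
    by move=> x y hx xy hy; apply: zg => //; exact: le_trans hy _.
  by exists xm => //; rewrite lexx x0'.
(* On the right the slope is negated rather than the interval reflected: the side bound does not
   care in which order slope 0 and the maximal slope occur. *)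
have Rt : p * kap `^ (p - 1) * rho m t2 - (p - 1) * kap `^ p * (1 - xm - t2 * u xm)
    + \int[mu]_(x in `[xm, 1]) defect t2 kap (fun x => - g x) (fun x => - z x) x <=
    \int[mu]_(x in `[xm, 1]) (speed (fun x => - g x) (fun x => - z x) x `^ p).
  rewrite -IR; apply: side_bound => //.
    move=> x y hx xy hy.
    rewrite (@eq_Rintegral _ _ _ mu _ (fun x => (- 1) * g x)); last first.
      by move=> s _; rewrite mulN1r.
    rewrite RintegralZl//.
      by rewrite -zg//; [ring|exact: le_trans hx].
    by apply: integrableS giR => //; apply: subset_itvScc; rewrite bnd_simp.
  by exists xm; [rewrite lexx x1'|rewrite zxm oppr0].
have speedN x : speed (fun x => - g x) (fun x => - z x) x = speed g z x.
  by rewrite /speed normrN dGN.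
have eN : \int[mu]_(x in `[xm, 1]) (speed (fun x => - g x) (fun x => - z x) x `^ p) =
    \int[mu]_(x in `[xm, 1]) (speed g z x `^ p).
  by apply: eq_Rintegral => x _; rewrite speedN.
rewrite {}eN in Rt.
have D2 : 0 <= \int[mu]_(x in `[xm, 1]) defect t2 kap (fun x => - g x) (fun x => - z x) x.
  by apply: Rintegral_ge0 => x _; exact: defect_ge0.
rewrite (@Rintegral_segment_cat R _ 0 xm 1)//; last exact: integrable_speed_powR.
have c0 : 0 < (p - 1) * kap `^ p by rewrite mulr_gt0 ?powR_gt0// subr_gt0.
have : (p - 1) * kap `^ p * ((t1 + t2) * h) <= (p - 1) * kap `^ p * ((t1 + t2) * u xm).
  by rewrite ler_pM2l// ler_pM2l// addr_gt0.
by move: L Rt D2; lra.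
Qed.

(** A nonnegative function with zero integral vanishes almost everywhere, and there [defect_eq0]
    identifies the speed. Nothing is learned about the sign of [g]. *)
Lemma defect0_speed t kap g z a b x y : a <= x -> x <= y -> y <= b -> 0 < kap ->
  continuous z -> mu.-integrable `[a, b] (EFin \o g) ->
  mu.-integrable `[a, b] (EFin \o (fun x => `|g x| `^ p)) ->
  (forall x, a <= x <= b -> t * z x <= 1) ->
  \int[mu]_(s in `[a, b]) defect t kap g z s = 0 ->
  \int[mu]_(s in `[x, y]) speed g z s =
  \int[mu]_(s in `[x, y]) (kap * gap t (z s) `^ p^-1).
Proof.
move=> ax xy yb k0 cz gi gp tz1 D0.
have ab : a <= b by rewrite (le_trans ax)// (le_trans xy).
have sub : `[x, y] `<=` `[a, b] by apply: subset_itvScc; rewrite bnd_simp.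
have [di _] := integral_defect kap ab cz gi gp tz1.
have dge s := defect_ge0 t g z s k0.
have di' : mu.-integrable `[x, y] (EFin \o defect t kap g z) by exact: integrableS di.
have d0 : \int[mu]_(s in `[x, y]) defect t kap g z s = 0.
  apply/le_anti/andP; split; last by apply: Rintegral_ge0.
  by rewrite -D0; exact: Rintegral_segment_le.
have md : measurable_fun `[x, y] (EFin \o defect t kap g z) by exact: measurable_int di'.
have gi' : mu.-integrable `[x, y] (EFin \o g) by exact: integrableS gi.
have si : mu.-integrable `[x, y] (EFin \o speed g z).
  by apply: integrableM_continuous; [exact: integrable_norm gi'|exact: continuous_dG_comp].
have bi : mu.-integrable `[x, y] (EFin \o (fun s => kap * gap t (z s) `^ p^-1)).
  apply: integrable_mull; apply: continuous_segment_integrable.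
  apply: continuous_subspaceT; apply: continuous_gap_powR => //.
  by rewrite invr_gt0 p_gt0.
have mI : measurable (`[x, y]%classic : set (measurableTypeR R)) by [].
have /(ae_eq_integral_abs mu mI md) ae0 :
    (\int[mu]_(s in `[x, y]) `|(EFin \o defect t kap g z) s| = 0)%E.
  transitivity (\int[mu]_(s in `[x, y]) (defect t kap g z s)%:E)%E.
    by apply: eq_integral => s _ /=; rewrite ger0_norm.
  rewrite -[LHS]fineK ?integrable_fin_num//.
  by congr EFin; exact: d0.
congr fine; apply: ae_eq_integral => //; [exact: measurable_int si|exact: measurable_int bi|].
apply: filterS ae0 => s /= h hs; congr EFin; apply: defect_eq0 => //.
by have [] := h hs.
Qed.

End Energy.

(** * The free elastica with vertical start after rotation *)

Section Arc.
Variables (R : realType) (p : R).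
Hypothesis p_gt1 : 1 < p.
Variable t : R.
Hypothesis t_gt0 : 0 < t.
Local Notation mu := (@lebesgue_measure R).
Local Notation m := (mexp p).
Implicit Types (s x y : R).

Let m0 : 0 < m. Proof. exact: mexp_gt0. Qed.
Let m12 : m < 1 / 2. Proof. exact: mexp_lt12. Qed.
Let sq1 (s : R) : 0 < 1 + s ^+ 2. Proof. exact: sq1_gt0. Qed.
#[local] Hint Resolve sq1 : core.

(* The rotated free elastica, parametrised by its rotated slope [y]:
   [arcx] and [arcu] are its coordinates measured from the initial point. *)
Definition arcx y := tailG m y + t * eta m y.
Definition arcu y := eta m y - t * tailG m y.

Lemma is_derive_arcx y : is_derive y 1 arcx (- (dG m y * (1 + t * y))).
Proof.
have d := is_derive1D (is_derive_tailG m y) (is_derive1Zl t (is_derive_eta m0 y)).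
by apply: (is_derive_eq d); ring.
Qed.

Lemma is_derive_arcu y : is_derive y 1 arcu ((t - y) * dG m y).
Proof.
have d := is_derive1B (is_derive_eta m0 y) (is_derive1Zl t (is_derive_tailG m y)).
by apply: (is_derive_eq d); ring.
Qed.

Lemma arcx_gt0 y : 0 < arcx y.
Proof. by rewrite addr_gt0 ?tailG_gt0// mulr_gt0// eta_gt0. Qed.

Lemma arcx_lt y1 y2 : 0 <= y1 -> y1 < y2 -> arcx y2 < arcx y1.
Proof.
move=> y10 y12; rewrite -ltrN2.
apply: (@is_derive1_lt R (fun y => - arcx y) (fun y => dG m y * (1 + t * y))) => //.
  move=> y _; apply: (is_derive_eq (is_derive1N (is_derive_arcx y))).
  by rewrite opprK.
move=> y /andP[y1y _]; rewrite mulr_gt0 ?dG_gt0// ltr_pwDl// mulr_ge0//.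
  exact: ltW.
by rewrite (le_trans y10)// ltW.
Qed.

Lemma arcx_inj y1 y2 : 0 <= y1 -> 0 <= y2 -> arcx y1 = arcx y2 -> y1 = y2.
Proof.
move=> y10 y20 e; apply/eqP; rewrite eq_le !leNgt; apply/andP; split; apply/negP.
  by move=> /(arcx_lt y20); rewrite e ltxx.
by move=> /(arcx_lt y10); rewrite e ltxx.
Qed.

Lemma arcx_small s : 0 < s -> exists2 y, 0 < y & arcx y < s.
Proof.
(* [arcx y] is at most [(1 + t) * eta m y] once [1 <= y], and this is below [s] exactly when
   [(1 + y ^+ 2) ^ m] exceeds [C]; hence the choice of [y]. *)
move=> s0; pose C := (1 + t) / (2 * m * s).
have t1 : 0 < 1 + t by rewrite addr_gt0.
have m2 : 0 < 2 * m by apply: mulr_gt0.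
have C0 : 0 < C by apply: divr_gt0 => //; apply: mulr_gt0.
pose y := 1 + C `^ m^-1.
have c0 : 0 < C `^ m^-1 by exact: powR_gt0.
have y1 : 1 <= y by rewrite /y lerDl ltW.
have y0 : 0 < y by apply: lt_le_trans y1.
exists y => //.
have eta0 := eta_gt0 m0 y.
have h1 : tailG m y <= eta m y.
  apply: le_trans (tailG_le m0 y0); rewrite ler_peMl// ltW// tailG_gt0//.
have h2 : arcx y <= (1 + t) * eta m y by rewrite mulrDl mul1r lerD2r.
apply: le_lt_trans h2 _.
have CP : C < (1 + y ^+ 2) `^ m.
  have -> : C = (C `^ m^-1) `^ m by rewrite -powRrM mulVf ?powRr1 ?ltW ?gt_eqF.
  have yy : y <= y ^+ 2 by rewrite expr2 ler_peMl// ltW.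
  have cy : C `^ m^-1 < 1 + y ^+ 2 by move: yy; rewrite {1}/y; lra.
  by apply: gt0_ltr_powR => //; rewrite nnegrE ltW.
move: CP; rewrite /C ltr_pdivrMr; last by apply: mulr_gt0.
move=> CP.
rewrite /eta powRN mulrA ltr_pdivrMr// ltr_pdivrMr ?powR_gt0//.
by apply: lt_le_trans CP _; rewrite le_eqVlt; apply/orP; left; apply/eqP; ring.
Qed.

(** The inverse of [arcx] on the open interval from 0 to [arcx 0]; the rotated slope tends to
    infinity as [s] decreases to 0. *)
Definition arcy s := xget 0 [set y | 0 < y /\ arcx y = s].

Lemma arcyP s : 0 < s < arcx 0 -> 0 < arcy s /\ arcx (arcy s) = s.
Proof.
move=> /andP[s0 sx].
suff [y [y0 ys]] : exists y, 0 < y /\ arcx y = s.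
  by apply: (@xgetPex _ 0 [set y | 0 < y /\ arcx y = s]); exists y.
have [y1 y10 y1s] := arcx_small s0.
have [||c] := @IVT R arcx 0 y1 s (ltW y10).
- by apply: continuous_subspaceT => y; exact: is_derive1_continuous (is_derive_arcx y).
- by rewrite ge_min le_max (ltW y1s) (ltW sx) orbT.
rewrite in_itv/= => /andP[c0 _] cs; exists c; split => //.
rewrite lt_neqAle c0 andbT; apply/eqP => e; move: sx.
by rewrite -cs -e ltxx.
Qed.

Lemma arcxK y : 0 < y -> arcy (arcx y) = y.
Proof.
move=> y0; have [|a e] := @arcyP (arcx y); first by rewrite arcx_gt0 arcx_lt.
by apply: arcx_inj => //; exact: ltW.
Qed.

Lemma is_derive_arcy s : 0 < s < arcx 0 ->
  is_derive s 1 arcy (- (dG m (arcy s) * (1 + t * arcy s)))^-1.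
Proof.
move=> hs; have [y0 e] := arcyP hs; set y := arcy s in y0 e *; rewrite -e.
apply: is_derive_inverse (is_derive_arcx y) _.
- by near=> w; apply: arcxK; near: w; exact: lt_nbhsr.
- by near=> w; exact: is_derive1_continuous (is_derive_arcx w).
- rewrite oppr_eq0 mulf_neq0// ?gt_eqF ?dG_gt0//.
  by rewrite ltr_pwDl// mulr_ge0// ltW.
Unshelve. all: by end_near. Qed.

Lemma arcy_le s y : 0 < y -> 0 < s -> s <= arcx y -> y <= arcy s.
Proof.
move=> y0 s0 sy; have [|a e] := @arcyP s.
  by rewrite s0 (le_lt_trans sy)// arcx_lt.
rewrite leNgt; apply/negP => /(arcx_lt (ltW a)).
by rewrite e ltNge sy.
Qed.

(** Slope of the elastica at abscissa [s], rotated back. For [s <= 0] the curve is continued by its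
    tangent of slope [t^-1]; this provides the straight initial segments of the competitors. *)
Definition zeta s := if 0 < s then (arcy s - t) / (1 + t * arcy s) else t^-1.
Definition vee s := if 0 < s then arcu (arcy s) else s / t.
Definition kap0 := (1 + t ^+ 2) `^ (m - 1).
Definition zslope s := - (kap0 * gap t (zeta s) `^ p^-1 / dG m (zeta s)).

Lemma denom_gt0 y : 0 < y -> 0 < 1 + t * y.
Proof. by move=> y0; rewrite ltr_pwDl// mulr_ge0// ltW. Qed.

Lemma one_sub_zeta s : 0 < s < arcx 0 ->
  1 - t * zeta s = (1 + t ^+ 2) / (1 + t * arcy s).
Proof.
move=> hs; have [y0 _] := arcyP hs; rewrite /zeta; case/andP: hs => -> _.
by have := denom_gt0 y0 => n; field; rewrite gt_eqF.
Qed.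

Lemma mul_zeta_le1 s : s < arcx 0 -> t * zeta s <= 1.
Proof.
move=> sx; have [s0|s0] := ltP 0 s; last first.
  by rewrite /zeta ltNge s0 /= divff// gt_eqF.
have hs : 0 < s < arcx 0 by rewrite s0.
rewrite -subr_ge0 one_sub_zeta//; apply: divr_ge0; apply: ltW => //.
by apply: denom_gt0; case: (arcyP hs).
Qed.

Lemma zeta_end : zeta (arcx t) = 0.
Proof. by rewrite /zeta arcx_gt0 arcxK// subrr mul0r. Qed.

Lemma is_derive_vee s : s < arcx 0 -> s != 0 -> is_derive s 1 vee (zeta s).
Proof.
move=> sx; rewrite neq_lt => /orP[s0|s0].
  have d := is_derive1Zl t^-1 (is_derive1_id s); rewrite mulr1 in d.
  have -> : zeta s = t^-1 by rewrite /zeta ltNge (ltW s0).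
  apply: is_derive1_near_eq d; near=> w; rewrite /vee ltNge.
  have -> : w <= 0 by apply/ltW; near: w; exact: lt_nbhsl.
  by rewrite /= mulrC.
have hs : 0 < s < arcx 0 by rewrite s0.
have [y0 _] := arcyP hs.
have d := is_derive1_compo (is_derive_arcu (arcy s)) (is_derive_arcy hs).
have d' : is_derive s 1 (fun s => arcu (arcy s)) (zeta s).
  apply: (is_derive_eq d); rewrite /zeta s0.
  by field; rewrite !gt_eqF ?dG_gt0 ?denom_gt0.
apply: is_derive1_near_eq d'; near=> w; rewrite /vee.
by have -> : 0 < w by near: w; exact: lt_nbhsr.
Unshelve. all: by end_near. Qed.

(** Reconciles the slope equation |(G zeta)'| = kap0 (1 - t zeta)^(1/p), which defines [zslope],
    with the derivative computed from the parametrisation. The link is the rotation identity with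
    [- t] in place of [t]. *)
Lemma zslopeE s : 0 < s < arcx 0 ->
  zslope s = - ((1 + t ^+ 2) / ((1 + t * arcy s) ^+ 3 * dG m (arcy s))).
Proof.
move=> hs; have [y0 _] := arcyP hs; set y := arcy s in y0 *.
have n0 : 0 < 1 + t * y := denom_gt0 y0.
have ge : gap t (zeta s) = (1 + t ^+ 2) / (1 + t * y).
  by rewrite /gap one_sub_zeta// max_r//; apply: divr_ge0; exact: ltW.
have zE : zeta s = (y + - t) / (1 - (- t) * y).
  by rewrite /zeta; case/andP: hs => -> _; rewrite mulNr opprK.
rewrite /zslope ge zE dG_rotate; last by rewrite mulNr (lt_trans _ ltr01)// oppr_lt0 mulr_gt0.
rewrite mulNr opprK dGN (dGE m t) /kap0.
set T := 1 + t ^+ 2; set N := 1 + t * y in n0 *; have T0 : 0 < T := sq1 t.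
have -> : (T / N) `^ p^-1 = T / N * ((T `^ m) ^- 2 * N `^ (2 * m)).
  have -> : p^-1 = 1 - 2 * m by rewrite mexp2// subKr.
  have TN : 0 < T / N by rewrite divr_gt0.
  rewrite powRB ?(gt_eqF TN) ?implybT// powRr1 ?(ltW TN)//; congr (_ * _).
  rewrite powRM ?invr_ge0 ?(ltW T0) ?(ltW n0)// invfM; congr (_ * _).
    by rewrite mulrC powRrM powR_mulrn ?powR_ge0.
  by rewrite -powR_inv1 ?(ltW n0)// powRAC powR_inv1 ?powR_ge0// invrK.
rewrite powRB ?(gt_eqF T0) ?implybT// powRr1 ?(ltW T0)//.
have P0 : 0 < T `^ m by exact: powR_gt0.
have Q0 : 0 < N `^ (2 * m) by exact: powR_gt0.
have D0 := dG_gt0 m y.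
by field; rewrite !gt_eqF.
Qed.

Lemma is_derive_zeta s : s < arcx 0 -> s != 0 -> is_derive s 1 zeta (zslope s).
Proof.
move=> sx; rewrite neq_lt => /orP[s0|s0].
  have -> : zslope s = 0.
    rewrite /zslope {1}/zeta ltNge (ltW s0) /= /gap divff ?gt_eqF// subrr maxxx.
    by rewrite powR0 ?mulr0 ?mul0r ?oppr0// invr_eq0 gt_eqF// p_gt0.
  apply: is_derive1_near_eq (is_derive1_cst t^-1 s); near=> w; rewrite /zeta ltNge.
  by have -> : w <= 0 by apply/ltW; near: w; exact: lt_nbhsl.
have hs : 0 < s < arcx 0 by rewrite s0.
have [y0 _] := arcyP hs; have n0 := denom_gt0 y0.
have dy := is_derive_arcy hs.
have n1 : 1 + t * arcy s != 0 by rewrite gt_eqF.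
have dn := is_derive1D (is_derive1_cst 1 s) (is_derive1Zl t dy).
have d := is_derive1M (is_derive1B dy (is_derive1_cst t s))
  (is_derive1V (f := fun s => 1 + t * arcy s) n1 dn).
have d' : is_derive s 1 (fun s => (arcy s - t) / (1 + t * arcy s)) (zslope s).
  apply: (is_derive_eq d); rewrite zslopeE//.
  by field; rewrite !gt_eqF ?dG_gt0.
apply: is_derive1_near_eq d'; near=> w; rewrite /zeta.
by have -> : 0 < w by near: w; exact: lt_nbhsr.
Unshelve. all: by end_near. Qed.

Lemma continuous_vee s : s < arcx 0 -> {for s, continuous vee}.
Proof.
move=> sx; have [->|s0] := eqVneq s 0; last first.
  exact: is_derive1_continuous (is_derive_vee sx s0).
(* At the junction [s = 0] the bound |vee w| <= (1/t + t) |w| is used: for [w > 0], [eta] is at most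
   [w / t] and [t * tailG] at most [t * w], because both parts of [arcx] are positive. *)
have c0 : 0 < t^-1 + t by rewrite addr_gt0// invr_gt0.
apply/cvgrPdist_lt => e e0.
have -> : vee 0 = 0 by rewrite /vee ltxx mul0r.
have d0 : 0 < e / (t^-1 + t) by rewrite divr_gt0.
near=> w.
have wx : w < arcx 0 by near: w; apply: lt_nbhsl; exact: arcx_gt0.
have we : `|w| < e / (t^-1 + t).
  rewrite ltr_norml; apply/andP; split; near: w; [apply: lt_nbhsr|exact: lt_nbhsl].
  by rewrite oppr_lt0.
move: we; rewrite ltr_pdivlMr// => we.
rewrite sub0r normrN; apply: le_lt_trans we.
rewrite /vee; case: ltP => w0.
  have hw : 0 < w < arcx 0 by rewrite w0.
  have [y0 ew] := arcyP hw; rewrite (gtr0_norm w0).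
  have a1 := tailG_gt0 m0 (arcy w); have a2 := eta_gt0 m0 (arcy w).
  have a3 : eta m (arcy w) <= w / t.
    by rewrite ler_pdivlMr// -{2}ew /arcx; lra.
  have a4 : t * tailG m (arcy w) <= t * w.
    rewrite ler_pM2l// -{2}ew /arcx.
    by have : 0 < t * eta m (arcy w); [rewrite mulr_gt0|lra].
  have a5 : 0 < t * tailG m (arcy w) by rewrite mulr_gt0.
  have a6 : 0 < w / t by rewrite divr_gt0.
  have a7 : 0 < t * w by rewrite mulr_gt0.
  by rewrite mulrDr (mulrC w t) ler_norml /arcu; lra.
by rewrite normrM [X in _ * X]gtr0_norm ?invr_gt0// ler_wpM2l// lerDl ltW.
Unshelve. all: by end_near. Qed.

Lemma continuous_zeta s : s < arcx 0 -> {for s, continuous zeta}.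
Proof.
move=> sx; have [->|s0] := eqVneq s 0; last first.
  exact: is_derive1_continuous (is_derive_zeta sx s0).
apply/cvgrPdist_lt => e e0.
have -> : zeta 0 = t^-1 by rewrite /zeta ltxx.
have T0 : 0 < 1 + t ^+ 2 by [].
(* Chosen so that [arcy w >= M] forces (1 + t^2) / (t (1 + t arcy w)), the distance of [zeta w] from
   [t^-1], below [e]. *)
pose M := (1 + t ^+ 2) / (t ^+ 2 * e).
have M0 : 0 < M by rewrite divr_gt0// mulr_gt0// exprn_gt0.
near=> w.
have wx : w < arcx M by near: w; apply: lt_nbhsl; exact: arcx_gt0.
have [w0|w0] := ltP 0 w; last by rewrite /zeta (ltNge 0 w) w0 /= subrr normr0.
have hw : 0 < w < arcx 0 by rewrite w0 (lt_trans wx)// arcx_lt.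
have My := arcy_le M0 w0 (ltW wx).
have y0 : 0 < arcy w by apply: lt_le_trans My.
have n0 := denom_gt0 y0.
have -> : t^-1 - zeta w = (1 + t ^+ 2) / (t * (1 + t * arcy w)).
  have -> : t^-1 - zeta w = t^-1 * (1 - t * zeta w).
    by rewrite mulrBr mulr1 mulKf// gt_eqF.
  by rewrite one_sub_zeta//; field; rewrite !gt_eqF.
rewrite gtr0_norm ?divr_gt0 ?mulr_gt0// ltr_pdivrMr ?mulr_gt0//.
move: My; rewrite /M ler_pdivrMr ?mulr_gt0 ?exprn_gt0// => My.
have te : 0 < e * t by rewrite mulr_gt0.
by apply: le_lt_trans My _; lra.
Unshelve. all: by end_near. Qed.

End Arc.

(** * The symmetric extremal curve with straight segments of horizontal length [del] at both ends *)

Section Extremal.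
Variables (R : realType) (p : R).
Hypothesis p_gt1 : 1 < p.
Variables (t del : R).
Hypotheses (t_gt0 : 0 < t) (del_ge0 : 0 <= del) (del_lt : del < 1 / 2).
Local Notation mu := (@lebesgue_measure R).
Local Notation m := (mexp p).
Local Notation ell := (1 / 2 - del).
Local Notation A0 := (arcx p t t).
Local Notation zeta := (zeta p t).
Local Notation vee := (vee p t).
Implicit Types (s x y : R).

Let ell0 : 0 < ell. Proof. by rewrite subr_gt0. Qed.
Let A00 : 0 < A0. Proof. exact: arcx_gt0. Qed.

(** Scaling factor: slope 0 is reached at abscissa [arcx p t t], which must be mapped to the
    distance [1 / 2 - del] between the end of a segment and the midpoint. *)
Definition lam := A0 / ell.

Lemma lam_gt0 : 0 < lam. Proof. by rewrite divr_gt0. Qed.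

Lemma lam_ell : lam * ell = A0. Proof. by rewrite divfK// gt_eqF. Qed.

Lemma A0_lt : A0 < arcx p t 0. Proof. exact: arcx_lt. Qed.

Definition sg x := lam * (Num.min x (1 - x) - del).

Lemma sg_le x : sg x <= A0.
Proof.
rewrite -lam_ell /sg ler_pM2l ?lam_gt0// lerD2r ge_min.
by have [h|h] := leP x (1 / 2); rewrite ?orbT//; apply/orP; right; lra.
Qed.

Lemma sg_lt x : sg x < arcx p t 0. Proof. exact: le_lt_trans (sg_le x) A0_lt. Qed.

Lemma continuous_sg : continuous sg.
Proof.
move=> x; apply: cvgMr; apply: cvgB; last exact: cvg_cst.
apply: (@continuous_min R R id (fun x => 1 - x)); first exact: cvg_id.
by apply: cvgB; [exact: cvg_cst|exact: cvg_id].
Qed.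

Definition rext x := zeta (sg x).
(** Odd reflection of [rext] about the midpoint, written without case distinction so that continuity
    is immediate; one of the two terms is always [rext (1 / 2) = 0]. *)
Definition zext x := rext (Num.min x (1 / 2)) - rext (Num.max x (1 / 2)).
Definition uext x := vee (sg x) / lam + del / t.
Definition kext := lam * kap0 p t.
Definition gext x := - (kext * gap t (rext x) `^ p^-1 / dG m (rext x)).

Lemma kext_gt0 : 0 < kext.
Proof. by rewrite mulr_gt0 ?lam_gt0// powR_gt0// sq1_gt0. Qed.

Lemma gextE x : gext x = lam * zslope p t (sg x).
Proof. by rewrite /gext /zslope /kext -/(rext x); ring. Qed.

Lemma continuous_rext : continuous rext.
Proof.
move=> x; apply: (@continuous_comp _ _ _ sg zeta); first exact: continuous_sg.
by apply: continuous_zeta => //; exact: sg_lt.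
Qed.

Lemma rext_half : rext (1 / 2) = 0.
Proof.
rewrite /rext /sg; have -> : Num.min (1 / 2) (1 - 1 / 2) = 1 / 2 :> R.
  by rewrite min_l//; lra.
by rewrite lam_ell zeta_end.
Qed.

Lemma mul_rext_le1 x : t * rext x <= 1.
Proof. by apply: mul_zeta_le1 => //; exact: sg_lt. Qed.

Lemma zext_left x : x <= 1 / 2 -> zext x = rext x.
Proof. by move=> h; rewrite /zext min_l// max_r// rext_half subr0. Qed.

Lemma zext_right x : 1 / 2 <= x -> zext x = - rext x.
Proof. by move=> h; rewrite /zext min_r// max_l// rext_half sub0r. Qed.

Lemma continuous_zext : continuous zext.
Proof.
move=> x; apply: cvgB.
  apply: (@continuous_comp _ _ _ (fun x => Num.min x (1 / 2)) rext).
    by apply: (@continuous_min R R id (cst (1 / 2))); [exact: cvg_id|exact: cvg_cst].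
  exact: continuous_rext.
apply: (@continuous_comp _ _ _ (fun x => Num.max x (1 / 2)) rext).
  by apply: (@continuous_max R R id (cst (1 / 2))); [exact: cvg_id|exact: cvg_cst].
exact: continuous_rext.
Qed.

Lemma continuous_uext : continuous uext.
Proof.
move=> x; apply: cvgD; last exact: cvg_cst.
apply: cvgMl; apply: (@continuous_comp _ _ _ sg vee); first exact: continuous_sg.
by apply: continuous_vee => //; exact: sg_lt.
Qed.

Lemma continuous_gext : continuous gext.
Proof.
move=> x; apply: cvgN; apply: cvgM.
  apply: cvgMr; apply: continuous_gap_powR; last exact: continuous_rext.
  by rewrite invr_gt0 p_gt0.
apply: cvgV; first by rewrite gt_eqF// dG_gt0.
by apply: continuous_dG_comp; exact: continuous_rext.
Qed.

Lemma gext_le0 x : gext x <= 0.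
Proof.
have k0 := ltW kext_gt0; have d0 := ltW (dG_gt0 m (rext x)).
rewrite oppr_le0; apply: divr_ge0 => //; apply: mulr_ge0 => //; exact: powR_ge0.
Qed.

Lemma sg_left x : x <= 1 / 2 -> sg x = lam * (x - del).
Proof. by move=> h; rewrite /sg min_l//; lra. Qed.

Lemma sg_right x : 1 / 2 <= x -> sg x = lam * (1 - x - del).
Proof. by move=> h; rewrite /sg min_r//; lra. Qed.

Definition corners := [:: del; 1 / 2; 1 - del].

Lemma corner_cases x : x \notin corners ->
  sg x != 0 /\ (x < 1 / 2 \/ 1 / 2 < x).
Proof.
rewrite !inE !negb_or => /and3P[x1 x2 x3]; split; last first.
  by move: x2; rewrite neq_lt => /orP[|]; [left|right].
have l0 := lt0r_neq0 lam_gt0.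
have [h|h] := leP x (1 / 2).
  by rewrite sg_left// mulf_neq0// subr_eq0.
rewrite sg_right ?(ltW h)// mulf_neq0//; apply: contra x3 => /eqP e.
by apply/eqP; lra.
Qed.

Lemma is_derive_affine (c e x : R) : is_derive x 1 (fun y => lam * (c * y + e)) (lam * c).
Proof.
have d := is_derive1Zl lam (is_derive1D (is_derive1Zl c (is_derive1_id x)) (is_derive1_cst e x)).
by apply: (is_derive_eq d); ring.
Qed.

Lemma is_derive_zext x : x \notin corners -> is_derive x 1 zext (gext x).
Proof.
move=> /corner_cases[s0 [h|h]]; rewrite gextE.
  have e : sg x = lam * (1 * x + - del) by rewrite sg_left ?(ltW h)//; ring.
  have dz : is_derive (lam * (1 * x + - del)) 1 zeta (zslope p t (sg x)).
    by rewrite -e; apply: is_derive_zeta => //; exact: sg_lt.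
  have d := is_derive1_compo (g := fun y => lam * (1 * y + - del)) dz
    (is_derive_affine 1 (- del) x).
  have d' := is_derive_eq d (_ : _ = lam * zslope p t (sg x)).
  apply: is_derive1_near_eq (d' _); last by ring.
  near=> y; have hy : y <= 1 / 2 by apply/ltW; near: y; exact: lt_nbhsl.
  by rewrite zext_left// /rext sg_left// mul1r.
have e : sg x = lam * (- 1 * x + (1 - del)) by rewrite sg_right ?(ltW h)//; ring.
have dz : is_derive (lam * (- 1 * x + (1 - del))) 1 zeta (zslope p t (sg x)).
  by rewrite -e; apply: is_derive_zeta => //; exact: sg_lt.
have d := is_derive1N (is_derive1_compo (g := fun y => lam * (- 1 * y + (1 - del))) dz
  (is_derive_affine (- 1) (1 - del) x)).
have d' := is_derive_eq d (_ : _ = lam * zslope p t (sg x)).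
apply: is_derive1_near_eq (d' _); last by ring.
near=> y; have hy : 1 / 2 <= y by apply/ltW; near: y; exact: lt_nbhsr.
rewrite zext_right// /rext sg_right//; congr (- zeta (_ * _)); by ring.
Unshelve. all: by end_near. Qed.

Lemma is_derive_uext x : x \notin corners -> is_derive x 1 uext (zext x).
Proof.
have l0 := lt0r_neq0 lam_gt0.
move=> /corner_cases[s0 [h|h]].
  have e : sg x = lam * (1 * x + - del) by rewrite sg_left ?(ltW h)//; ring.
  have dz : is_derive (lam * (1 * x + - del)) 1 vee (zeta (sg x)).
    by rewrite -e; apply: is_derive_vee => //; exact: sg_lt.
  have d := is_derive1D (is_derive1Zl lam^-1 (is_derive1_compo
    (g := fun y => lam * (1 * y + - del)) dz (is_derive_affine 1 (- del) x)))
    (is_derive1_cst (del / t) x).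
  have d' := is_derive_eq d (_ : _ = zext x).
  apply: is_derive1_near_eq (d' _); last by rewrite zext_left ?(ltW h)// /rext; field.
  near=> y; have hy : y <= 1 / 2 by apply/ltW; near: y; exact: lt_nbhsl.
  by rewrite /uext sg_left// mul1r mulrC.
have e : sg x = lam * (- 1 * x + (1 - del)) by rewrite sg_right ?(ltW h)//; ring.
have dz : is_derive (lam * (- 1 * x + (1 - del))) 1 vee (zeta (sg x)).
  by rewrite -e; apply: is_derive_vee => //; exact: sg_lt.
have d := is_derive1D (is_derive1Zl lam^-1 (is_derive1_compo
  (g := fun y => lam * (- 1 * y + (1 - del))) dz (is_derive_affine (- 1) (1 - del) x)))
  (is_derive1_cst (del / t) x).
have d' := is_derive_eq d (_ : _ = zext x).
apply: is_derive1_near_eq (d' _); last by rewrite zext_right ?(ltW h)// /rext; field.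
near=> y; have hy : 1 / 2 <= y by apply/ltW; near: y; exact: lt_nbhsr.
rewrite /uext sg_right// mulrC; congr (vee (_ * _) / _ + _); by ring.
Unshelve. all: by end_near. Qed.

Lemma slope_ext : slope_data p uext zext gext.
Proof.
have ci (f : R -> R) : continuous f -> mu.-integrable `[0, 1] (EFin \o f).
  by move=> cf; apply: continuous_segment_integrable; exact: continuous_subspaceT.
split.
- exact: continuous_zext.
- exact/ci/continuous_gext.
- have : mu.-integrable `[0, 1] (EFin \o (fun x => (Num.max 0 `|gext x|) `^ p)).
    apply: ci => x.
    apply: (@continuous_comp _ _ _ (fun x => `|gext x|) (fun v => (Num.max 0 v) `^ p)).
      apply: (@continuous_comp _ _ _ gext (fun v : R => `|v|)).
        exact: continuous_gext.
      exact: norm_continuous.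
    by apply: continuous_max0_powR; exact: p_gt0.
  by apply: eq_integrable => // x _ /=; rewrite max_r.
- move=> x y _ xy _; apply/esym; apply: (@FTC2_except R corners) => //.
  + exact: continuous_zext.
  + exact: continuous_gext.
  + by move=> w _; exact: is_derive_zext.
- move=> x y _ xy _; apply/esym; apply: (@FTC2_except R corners) => //.
  + exact: continuous_uext.
  + exact: continuous_zext.
  + by move=> w _; exact: is_derive_uext.
Qed.

Lemma uext0 : uext 0 = 0.
Proof.
rewrite /uext sg_left; last by rewrite divr_ge0.
rewrite sub0r /vee ltNge mulr_ge0_le0 ?oppr_le0 ?(ltW lam_gt0)//=.
by field; rewrite !gt_eqF ?lam_gt0.
Qed.

Lemma uext_sym x : uext x = uext (1 - x).
Proof.
rewrite /uext /sg; congr (vee (_ * (_ - _)) / _ + _).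
have -> : 1 - (1 - x) = x by ring.
by rewrite minC.
Qed.

(** The scaled elastic cap plus the rise [del / t] of a segment of slope [1 / t]. *)
Definition height := ell * (1 - 2 * m * t * rho m t) / (2 * m * rho m t + t) + del / t.

Lemma A0E : A0 = (rho m t + t / (2 * m)) / (1 + t ^+ 2) `^ m.
Proof.
have m0 := mexp_gt0 p_gt1.
rewrite /arcx /rho /eta powRN.
have P0 : 0 < (1 + t ^+ 2) `^ m by rewrite powR_gt0// sq1_gt0.
by field; rewrite !gt_eqF.
Qed.

Lemma uext_half : uext (1 / 2) = height.
Proof.
have m0 := mexp_gt0 p_gt1.
have P0 : 0 < (1 + t ^+ 2) `^ m by rewrite powR_gt0// sq1_gt0.
have r0 := rho_gt0 m0 t.
rewrite /uext sg_left// lam_ell /vee A00 arcxK// /height; congr (_ + _).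
have -> : arcu p t t = (1 - 2 * m * t * rho m t) / (2 * m * (1 + t ^+ 2) `^ m).
  by rewrite /arcu /rho /eta powRN; field; rewrite !gt_eqF.
rewrite /lam A0E.
have q1 : 0 < 2 * m * rho m t + t.
  by rewrite addr_gt0//; apply: mulr_gt0 r0; apply: mulr_gt0.
have q2 : 0 < rho m t * (2 * m) + t by rewrite mulrC.
have l0 := ell0; set l := 1 / 2 - del in l0 *.
by field; rewrite !gt_eqF.
Qed.

Lemma kextE : kext = (rho m t + t / (2 * m)) / ((1 + t ^+ 2) * ell).
Proof.
have m0 := mexp_gt0 p_gt1.
have T0 : 0 < 1 + t ^+ 2 := sq1_gt0 t.
have P0 : 0 < (1 + t ^+ 2) `^ m by rewrite powR_gt0.
rewrite /kext /kap0 /lam A0E powRB ?(gt_eqF T0) ?implybT// powRr1 ?(ltW T0)//.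
have l0 := ell0; set l := 1 / 2 - del in l0 *.
by field; rewrite !gt_eqF.
Qed.

Lemma speed_ext x : speed p gext zext x = kext * gap t (rext x) `^ p^-1.
Proof.
have -> : speed p gext zext x = `|gext x| * dG m (rext x).
  rewrite /speed; congr (_ * _); have [h|h] := leP x (1 / 2).
    by rewrite zext_left.
  by rewrite zext_right ?(ltW h)// dGN.
rewrite ler0_norm ?gext_le0// opprK divfK// gt_eqF//.
exact: dG_gt0.
Qed.

(** The curve has the equality speed of Young's inequality at every point, so its density is
    [kext ^ p] times [1 - t * rext x], and [rext] integrates to twice the height. *)
Lemma Ep_ext : Ep p uext = (kext `^ p * (1 - 2 * t * height))%:E.
Proof.
rewrite (Ep_slope p_gt1 slope_ext); congr EFin.
have ci a b (f : R -> R) : continuous f -> mu.-integrable `[a, b] (EFin \o f).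
  by move=> cf; apply: continuous_segment_integrable; exact: continuous_subspaceT.
have ir a b := ci a b _ continuous_rext.
have iz a b := ci a b _ continuous_zext.
have [h0 h1 h01] : [/\ 0 <= 1 / 2 :> R, 1 / 2 <= 1 :> R & 0 <= 1 :> R] by split; lra.
have Ir : \int[mu]_(x in `[0, 1]) rext x = 2 * height.
  rewrite (Rintegral_segment_cat h0 h1 (ir 0 1)).
  have -> : \int[mu]_(x in `[0, 1 / 2]) rext x = height.
    rewrite (@eq_Rintegral _ _ _ mu _ zext); last first.
      by move=> x; rewrite inE/= in_itv/= => /andP[_ h]; rewrite zext_left.
    by rewrite -(slope_primitive slope_ext)// uext0 uext_half subr0.
  have -> : \int[mu]_(x in `[1 / 2, 1]) rext x = height.
    rewrite (@eq_Rintegral _ _ _ mu _ (fun x => (- 1) * zext x)); last first.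
      move=> x; rewrite inE/= in_itv/= => /andP[h _].
      by rewrite zext_right// mulN1r opprK.
    rewrite RintegralZl// -(slope_primitive slope_ext)// uext_half uext_sym subrr uext0.
    by ring.
  by ring.
rewrite (@eq_Rintegral _ _ _ mu _ (fun x => kext `^ p * (1 - t * rext x))); last first.
  move=> x _; rewrite speed_ext powRM ?powR_ge0 ?(ltW kext_gt0)//.
  rewrite -powRrM mulVf ?gt_eqF ?p_gt0// powRr1 ?gap_ge0//.
  by rewrite /gap max_r// subr_ge0 mul_rext_le1.
have itr : mu.-integrable `[0, 1] (EFin \o (fun x => t * rext x)).
  exact: integrable_mull.
have i1 : mu.-integrable `[0, 1] (EFin \o (fun=> 1 : R)).
  by apply: ci => x; exact: cvg_cst.
rewrite RintegralZl//; last first.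
  by apply: ci => x; apply: cvgB; [exact: cvg_cst|apply: cvgMr; exact: continuous_rext].
rewrite RintegralB// RintegralZl// Ir Rintegral_segment_cst//.
by congr (_ * _); ring.
Qed.

Lemma zext_nonincr x y : 0 <= x -> x <= y -> y <= 1 -> zext y <= zext x.
Proof.
move=> x0 xy y1; rewrite -subr_le0 (slope_sub slope_ext)//.
have -> : 0 = \int[mu]_(s in `[x, y]) (0 : R) by rewrite Rintegral_segment_cst// mul0r.
have ci (f : R -> R) : continuous f -> mu.-integrable `[x, y] (EFin \o f).
  by move=> cf; apply: continuous_segment_integrable; exact: continuous_subspaceT.
apply: le_Rintegral => //; first exact/ci/continuous_gext.
- by apply: ci => s; exact: cvg_cst.
- by move=> s _; exact: gext_le0.
Qed.

Lemma G_zext x y : x <= y -> y <= 1 / 2 ->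
  G m (zext x) - G m (zext y) =
  \int[mu]_(s in `[x, y]) (kext * gap t (zext s) `^ p^-1).
Proof.
move=> xy y2.
have cG : continuous (fun s => G m (zext s)).
  move=> s; apply: (@continuous_comp _ _ _ zext (G m)); first exact: continuous_zext.
  exact: is_derive1_continuous (is_derive_G m _).
have cd : continuous (fun s => - (dG m (zext s) * gext s)).
  move=> s; apply: cvgN; apply: cvgM; last exact: continuous_gext.
  by apply: continuous_dG_comp; exact: continuous_zext.
have h : \int[mu]_(s in `[x, y]) (- (dG m (zext s) * gext s)) =
    - G m (zext y) - - G m (zext x).
  apply: (@FTC2_except R corners (fun s => - G m (zext s))) => //.
    by move=> s; apply: cvgN; exact: cG.
  move=> w _ hw; have d := is_derive1_compo (is_derive_G m (zext w)) (is_derive_zext hw).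
  exact: is_derive1N.
have -> : G m (zext x) - G m (zext y) = - G m (zext y) - - G m (zext x).
  by rewrite opprK addrC.
rewrite -h; apply: eq_Rintegral => s; rewrite inE/= in_itv/= => /andP[_ sy].
rewrite zext_left ?(le_trans sy)// /gext.
by field; rewrite gt_eqF// dG_gt0.
Qed.

End Extremal.

(** * Sharp energy bounds above and below the threshold height *)

Section Bounds.
Variables (R : realType) (p : R).
Hypothesis p_gt1 : 1 < p.
Local Notation mu := (@lebesgue_measure R).
Local Notation m := (mexp p).
Implicit Types (u v z g psi : R -> R) (x y t h : R).

Let m0 : 0 < m. Proof. exact: mexp_gt0. Qed.
Let m12 : m < 1 / 2. Proof. exact: mexp_lt12. Qed.
Let p0 : 0 < p. Proof. exact: p_gt0. Qed.
Let K0 : 0 < K m. Proof. exact: K_gt0. Qed.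

Definition hstar := (4 * m * K m)^-1.

Lemma hstar_gt0 : 0 < hstar.
Proof. by rewrite invr_gt0; apply: mulr_gt0 => //; apply: mulr_gt0. Qed.

Lemma powR_pred (k : R) : 0 < k -> k `^ p = k `^ (p - 1) * k.
Proof. by move=> k0; rewrite mulrC mulr_powRB1// ltW. Qed.

(** With kap = 2K and rho t > K - t, the bound exceeds (2K)^p plus (2K)^(p-1) (t1 + t2) (2K (p-1) h
    - p), and [hstar] is the height at which the last factor vanishes. *)
Lemma energy_gt u z g (xm h : R) : slope_data p u z g -> u 0 = 0 -> u 1 = 0 ->
  0 < xm < 1 -> z xm = 0 -> hstar <= h -> h <= u xm ->
  (2 * K m) `^ p < \int[mu]_(x in `[0, 1]) (speed p g z x `^ p).
Proof.
move=> sd u0 u1 xm01 zxm hh hu; have h0 : 0 < h := lt_le_trans hstar_gt0 hh.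
have k0 : 0 < 2 * K m by rewrite mulr_gt0.
have [t1 [t2 [t10 t20 _]]] := energy_bound p_gt1 sd u0 u1 xm01 zxm h0 hu k0.
apply: lt_le_trans; apply: (@lt_le_trans _ _ (p * (2 * K m) `^ (p - 1) * (rho m t1 + rho m t2) -
  (p - 1) * (2 * K m) `^ p * (1 - h * (t1 + t2)))); last first.
  by rewrite lerDl; apply: Rintegral_ge0 => x _; exact: defect_ge0.
have tan (t : R) : 0 < t -> K m - t < rho m t.
  move=> t0; have := rho_tangent m0 m12 (lexx 0) (ltW t0) (lt0r_neq0 t0).
  by rewrite rho0 drho0 subr0 mulN1r.
have c0 : 0 < (2 * K m) `^ (p - 1) by exact: powR_gt0.
rewrite (powR_pred k0); set c := (2 * K m) `^ (p - 1) in c0 *.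
have s1 : p * c * (2 * K m - (t1 + t2)) < p * c * (rho m t1 + rho m t2).
  by rewrite ltr_pM2l ?mulr_gt0//; have := tan _ t10; have := tan _ t20; lra.
have s2 : p <= (p - 1) * (2 * K m) * h.
  have e : (p - 1) * (2 * K m) * hstar = p.
    rewrite -(mulp_mexp2 p_gt1) /hstar; field.
    by rewrite !gt_eqF.
  rewrite -{1}e ler_wpM2l//; apply: mulr_ge0; last exact: ltW.
  by rewrite subr_ge0 ltW.
have s3 : p * (c * (t1 + t2)) <= (p - 1) * (2 * K m) * h * (c * (t1 + t2)).
  by apply: ler_wpM2r s2; rewrite ltW// mulr_gt0// addr_gt0.
by move: s1 s3; lra.
Qed.

(** Taking [del = h * t] lets the straight segments alone rise to [h]. As [t] tends to 0, [kext]
    tends to [2 * K m], while the factor [1 - 2 * t * height] is at most 1. *)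
Lemma competitor_energy h (E : R) : 0 < h -> (2 * K m) `^ p < E ->
  exists2 t, 0 < t & [/\ h * t < 1 / 2, h <= height p t (h * t) &
    kext p t (h * t) `^ p * (1 - 2 * t * height p t (h * t)) < E].
Proof.
move=> h0 hE.
pose N (t : R) := rho m t + (2 * m)^-1 * t.
pose D (t : R) := (1 + t * t) * (1 / 2 - h * t).
have D0 : D 0 = 1 / 2 by rewrite /D; ring.
have N0 : N 0 = K m by rewrite /N rho0 mulr0 addr0.
have n0 : D 0 != 0 by rewrite D0; lra.
have dN := is_derive1D (is_derive_rho m 0) (is_derive1Zl (2 * m)^-1 (is_derive1_id (0 : R))).
have dD := is_derive1M (is_derive1D (is_derive1_cst 1 (0 : R))
     (is_derive1M (is_derive1_id (0 : R)) (is_derive1_id 0)))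
   (is_derive1B (is_derive1_cst (1 / 2) (0 : R)) (is_derive1Zl h (is_derive1_id 0))).
have cq := is_derive1_continuous (is_derive1M dN (is_derive1V (f := D) n0 dD)).
have k0 : 0 < 2 * K m by rewrite mulr_gt0.
have e0 : N 0 / D 0 = 2 * K m by rewrite N0 D0; field.
have cp : {for N 0 / D 0, continuous (fun v : R => v `^ p)}.
  by rewrite e0; exact: is_derive1_continuous (is_derive1_powR p k0).
have ck : {for 0, continuous (fun t : R => (N t / D t) `^ p)}.
  exact: (@continuous_comp _ _ _ (fun t => N t / D t) (fun v : R => v `^ p)).
have E0 : 0 < E - (2 * K m) `^ p by rewrite subr_gt0.
move/cvgrPdist_lt : ck => /(_ _ E0)/nbhs_ballP[d /= d0 hd].
(* The first bound gives the continuity estimate at 0, the second keeps [h * t] at most 1/4, so the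
   segments leave room for the cap. *)
pose t := Num.min (d / 2) (4 * h)^-1.
have t0 : 0 < t by rewrite lt_min !divr_gt0// invr_gt0 mulr_gt0.
have td : t <= d / 2 by rewrite ge_min lexx.
have th : t <= (4 * h)^-1 by rewrite ge_min lexx orbT.
have ht : h * t <= 1 / 4.
  move: th; rewrite -[_^-1]mul1r ler_pdivlMr ?mulr_gt0//; lra.
have dl : h * t < 1 / 2 by lra.
have ht0 : 0 <= h * t by rewrite mulr_ge0// ltW.
have r0 := rho_gt0 m0 t.
have q0 : 0 < 2 * m * rho m t + t.
  by rewrite addr_gt0//; apply: mulr_gt0 r0; apply: mulr_gt0.
have hh : h <= height p t (h * t).
  rewrite /height mulfK ?gt_eqF// lerDr divr_ge0 ?(ltW q0)// mulr_ge0//.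
    by rewrite subr_ge0 ltW.
  by rewrite subr_ge0 rho_le// ltW.
exists t => //; split => //.
have kp : kext p t (h * t) `^ p < E.
  have : `|(N 0 / D 0) `^ p - (N t / D t) `^ p| < E - (2 * K m) `^ p.
    by apply: hd; rewrite /ball/= sub0r normrN gtr0_norm//; move: d0 td; lra.
  have -> : N t / D t = kext p t (h * t).
    rewrite kextE// /N /D -expr2; congr (_ / _); congr (_ + _); exact: mulrC.
  by rewrite e0 ltr_norml; lra.
apply: le_lt_trans kp; rewrite ler_piMr ?powR_ge0// gerBl.
apply: mulr_ge0; last by rewrite (le_trans (ltW h0)).
by apply: mulr_ge0 => //; exact: ltW.
Qed.

(** The second identity cancels the coefficient of t1 + t2 in the energy bound once [rho] is
    replaced by its tangent at [t]; the third makes the remaining constant equal to the energy of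
    the elastica. All three follow from the single equation of [exists_slope]. *)
Lemma optimal_slope h : 0 < h -> h < hstar ->
  exists2 t, 0 < t & let k := kext p t 0 in
    [/\ height p t 0 = h, p * drho m t + (p - 1) * k * h = 0 &
        k * (1 - 2 * t * h) = 2 * rho m t].
Proof.
move=> h0 hh; have [t t0 e] := exists_slope m0 h0 hh; exists t => //= .
have T0 : 0 < 1 + t ^+ 2 := sq1_gt0 t.
have r0 := rho_gt0 m0 t.
have q0 : 0 < 2 * m * rho m t + t.
  by rewrite addr_gt0//; apply: mulr_gt0 r0; apply: mulr_gt0.
have d0 : (0 : R) < 1 / 2 by lra.
have hE : h = (1 - 2 * m * t * rho m t) / (2 * (2 * m * rho m t + t)).
  by rewrite -e; field; rewrite gt_eqF.
have kE : kext p t 0 = (2 * m * rho m t + t) / (m * (1 + t ^+ 2)).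
  by rewrite kextE//; field; rewrite !gt_eqF.
split.
- rewrite /height hE mul0r addr0; field.
  by rewrite !gt_eqF.
- rewrite kE hE -(mulp_mexp2 p_gt1) /drho; field.
  by rewrite !gt_eqF.
- rewrite kE hE; field.
  by rewrite !gt_eqF.
Qed.

(** In the equality case strict convexity of [rho] forces [t1 = t], and the left defect, the
    remaining nonnegative slack, must integrate to 0. *)
Lemma energy_ge u z g (xm h t kap : R) : slope_data p u z g -> u 0 = 0 -> u 1 = 0 ->
  0 < xm < 1 -> z xm = 0 -> 0 < h -> h <= u xm -> 0 < t -> 0 < kap ->
  p * drho m t + (p - 1) * kap * h = 0 -> kap * (1 - 2 * t * h) = 2 * rho m t ->
  kap `^ p * (1 - 2 * t * h) <= \int[mu]_(x in `[0, 1]) (speed p g z x `^ p) /\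
  (\int[mu]_(x in `[0, 1]) (speed p g z x `^ p) <= kap `^ p * (1 - 2 * t * h) ->
   (forall x, 0 <= x <= xm -> t * z x <= 1) /\
   \int[mu]_(x in `[0, xm]) defect p t kap g z x = 0).
Proof.
move=> sd u0 u1 xm01 zxm h0 hu t0 k0 e1 e2.
have [t1 [t2 [t10 t20 t1z]]] := energy_bound p_gt1 sd u0 u1 xm01 zxm h0 hu k0.
set I := \int[mu]_(x in `[0, 1]) _.
have Dge s : 0 <= \int[mu]_(x in `[0, xm]) defect p s kap g z x.
  by apply: Rintegral_ge0 => x _; exact: defect_ge0.
have c0 : 0 < kap `^ (p - 1) by exact: powR_gt0.
rewrite (powR_pred k0); set c := kap `^ (p - 1) in c0 * => hI.
have pc0 : 0 < p * c by rewrite mulr_gt0.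
have tan s : 0 < s -> s != t -> rho m t + drho m t * (s - t) < rho m s.
  by move=> s0 st; apply: rho_tangent => //; exact: ltW.
have tanW s : 0 < s -> rho m t + drho m t * (s - t) <= rho m s.
  move=> s0; have [->|st] := eqVneq s t; first by rewrite subrr mulr0 addr0.
  exact/ltW/tan.
have key : c * kap * (1 - 2 * t * h) =
    p * c * (2 * rho m t + drho m t * (t1 + t2 - 2 * t))
    - (p - 1) * (c * kap) * (1 - h * (t1 + t2)).
  have -> : p * c * (2 * rho m t + drho m t * (t1 + t2 - 2 * t)) =
      c * (p * (2 * rho m t)) + c * (p * drho m t) * (t1 + t2 - 2 * t) by ring.
  have -> : p * drho m t = - ((p - 1) * kap * h) by apply/eqP; rewrite -addr_eq0 e1.
  by rewrite -e2; ring.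
have low : p * c * (2 * rho m t + drho m t * (t1 + t2 - 2 * t)) <=
    p * c * (rho m t1 + rho m t2).
  by rewrite ler_pM2l//; have := tanW _ t10; have := tanW _ t20; lra.
have Dge1 := Dge t1; move: hI Dge1.
set Df := \int[mu]_(x in `[0, xm]) _ => hI Dge1; split.
  by rewrite key; move: hI low Dge1; lra.
move=> hle; have [t1t|t1t] := eqVneq t1 t; last first.
  have low' : p * c * (2 * rho m t + drho m t * (t1 + t2 - 2 * t)) <
      p * c * (rho m t1 + rho m t2).
    by rewrite ltr_pM2l//; have := tan _ t10 t1t; have := tanW _ t20; lra.
  by exfalso; move: hI low' Dge1 hle; rewrite key; lra.
split; first by rewrite -t1t.
apply/le_anti/andP; split; last exact: Dge.
by rewrite -t1t -/Df; move: hI low hle; rewrite key; lra.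
Qed.

Lemma slope_sym_half u z g : slope_data p u z g ->
  (forall x, 0 <= x <= 1 -> u x = u (1 - x)) -> z (1 / 2) = 0.
Proof.
move=> sd us.
have h01 : 0 < (1 / 2 : R) < 1 by lra.
have d1 := slope_derive sd h01.
have e : 1 - 1 / 2 = 1 / 2 :> R by lra.
have d1' : is_derive (1 - 1 / 2 : R) 1 u (z (1 / 2)) by rewrite e.
have d2 := is_derive1_compo (g := fun x => 1 - x) d1'
  (is_derive1B (is_derive1_cst 1 (1 / 2 : R)) (is_derive1_id (1 / 2 : R))).
have d3 : is_derive (1 / 2 : R) 1 u (z (1 / 2) * (0 - 1)).
  apply: is_derive1_near_eq d2; near=> x; rewrite -us//; apply/andP; split; apply: ltW.
    by near: x; apply: lt_nbhsr; lra.
  by near: x; apply: lt_nbhsl; lra.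
have e1 := @derive_val _ _ _ _ _ _ _ d1.
have := @derive_val _ _ _ _ _ _ _ d3; rewrite e1.
by lra.
Unshelve. all: by end_near. Qed.

Lemma G_mean_value (s1 s2 M : R) : s1 <= s2 ->
  (forall s, s1 <= s <= s2 -> dG m s <= M) -> `|G m s2 - G m s1| <= M * (s2 - s1).
Proof.
rewrite le_eqVlt => /predU1P[->|s12] hM; first by rewrite !subrr normr0 mulr0.
have [c /andP[c1 c2] ->] := MVT_everywhere s12 (fun s _ => is_derive_G m s).
rewrite ger0_norm; first by rewrite ler_pM2r ?subr_gt0// hM// !ltW.
by rewrite mulr_ge0 ?subr_ge0 ?(ltW s12)// ltW// dG_gt0.
Qed.

Lemma first_zero (d : R -> R) a b : a <= b -> continuous d -> 0 < d a -> d b = 0 ->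
  exists2 y, a <= y <= b & d y = 0 /\ forall w, a <= w <= y -> 0 <= d w.
Proof.
move=> ab cd da db; pose S := [set w | a <= w <= b /\ d w = 0].
have Sb : S b by split => //; rewrite ab lexx.
have hS : has_inf S by split; [exists b|exists a => x [/andP[]]].
set y := inf S.
have ay : a <= y by apply: lb_le_inf; [exists b|move=> x [/andP[]]].
have yb : y <= b by apply: ge_inf Sb; exists a => x [/andP[]].
have dy : d y = 0.
  apply/eqP; apply/negPn/negP => ny.
  have n0 : 0 < `|d y| by rewrite normr_gt0.
  have /cvgrPdist_lt/(_ _ n0)/nbhs_ballP[e /= e0 he] := cd y.
  have [s [sab ds] sy] := inf_adherent e0 hS.
  have ys : y <= s by apply: ge_inf; [exists a => x [/andP[]]|split].
  have := he s; rewrite /ball/= ds subr0 ltxx => /(_ _)/negP; case => //.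
  by rewrite ler0_norm ?subr_le0//; move: sy; rewrite -/y; lra.
exists y; first by rewrite ay yb.
split=> // w /andP[aw wy]; rewrite leNgt; apply/negP => dw.
have [||c] := @IVT R d a w 0 aw; first exact: continuous_subspaceT.
  by rewrite ge_min le_max (ltW dw) (ltW da) orbT.
rewrite in_itv/= => /andP[ac cw] dc.
have yc : y <= c.
  apply: ge_inf; first by exists a => x [/andP[]].
  by split => //; rewrite ac (le_trans cw)// (le_trans wy).
have ew : w = y by apply/le_anti; rewrite wy (le_trans yc).
by move: dw; rewrite ew dy ltxx.
Qed.

(* Both slopes leave [0] at [1/2] and are governed, backwards in [x], by the
   same rate, which decreases in the slope; so the extremal slope is largest. *)
Lemma slope_le_ext u z g t : 0 < t -> slope_data p u z g -> z (1 / 2) = 0 ->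
  (forall x, 0 <= x <= 1 / 2 -> t * z x <= 1) ->
  \int[mu]_(x in `[0, 1 / 2]) defect p t (kext p t 0) g z x = 0 ->
  forall x, 0 <= x <= 1 / 2 -> z x <= zext p t 0 x.
Proof.
move=> t0 [cz gi gp zg _] zh tz1 D0 x /andP[x0 xh].
have d0 : (0 : R) < 1 / 2 by lra.
have k0 : 0 < kext p t 0 by exact: kext_gt0.
rewrite leNgt; apply/negP => lt.
have cze : continuous (zext p t 0) by exact: continuous_zext.
(* If [z] exceeds the extremal slope at [x], let [y] be the first later point where they agree. In
   between [z] is larger, so its gap and its speed are smaller, and [G] of [z] drops by no more than
   [G] of the extremal slope: impossible with equal values at [y]. *)
have [||||y /andP[xy yh] [dy dpos]] := @first_zero (fun x => z x - zext p t 0 x) x (1 / 2).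
- exact: xh.
- by move=> w; apply: cvgB; [exact: cz|exact: cze].
- by rewrite subr_gt0.
- by rewrite zh zext_left// rext_half// subrr.
have zy : z y = zext p t 0 y by apply/eqP; rewrite -subr_eq0 dy.
have sub1 : `[0, 1 / 2] `<=` `[0, (1 : R)].
  by apply: subset_itvScc; rewrite bnd_simp//; lra.
have gi1 : mu.-integrable `[0, 1 / 2] (EFin \o g) by exact: integrableS gi.
have gp1 : mu.-integrable `[0, 1 / 2] (EFin \o (fun x => `|g x| `^ p)).
  exact: integrableS gp.
have giy : mu.-integrable `[x, y] (EFin \o g).
  by apply: integrableS gi1 => //; apply: subset_itvScc; rewrite bnd_simp.
have c1 : `|G m (z y) - G m (z x)| <= \int[mu]_(s in `[x, y]) speed p g z s.
  apply: (@chain_norm_bound R g z (G m) (dG m) x y t^-1) => //.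
  - exact: continuous_dG.
  - by move=> s; exact/ltW/dG_gt0.
  - move=> v w xv vw wy; apply: zg => //; first exact: le_trans xv.
    by rewrite (le_trans wy)// (le_trans yh)//; lra.
  - move=> v /andP[xv vy]; rewrite -[_^-1]mul1r ler_pdivlMr// mulrC; apply: tz1.
    by rewrite (le_trans x0)// (le_trans vy).
  - by move=> s1 s2 M s12 _; exact: G_mean_value.
rewrite (defect0_speed p_gt1 x0 xy yh k0 cz gi1 gp1 tz1 D0) in c1.
have cgap w : continuous w -> mu.-integrable `[x, y]
    (EFin \o (fun s => kext p t 0 * gap t (w s) `^ p^-1)).
  move=> cw; apply: integrable_mull; apply: continuous_segment_integrable.
  apply: continuous_subspaceT; apply: continuous_gap_powR => //.
  by rewrite invr_gt0.
have c2 : \int[mu]_(s in `[x, y]) (kext p t 0 * gap t (z s) `^ p^-1) <=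
    \int[mu]_(s in `[x, y]) (kext p t 0 * gap t (zext p t 0 s) `^ p^-1).
  apply: le_Rintegral; [by []|exact: cgap|exact: cgap|].
  move=> s /=; rewrite in_itv/= => hs; rewrite ler_pM2l//.
  apply: ge0_ler_powR; rewrite ?nnegrE ?gap_ge0//; first by rewrite invr_ge0 ltW.
  have := dpos s hs; rewrite subr_ge0 -(ler_pM2l t0) => hz.
  by rewrite /gap ge_max !le_max lexx /= lerB// orbT.
rewrite -G_zext// -zy in c2.
have := G_lt m lt; have := ler_norm (G m (z x) - G m (z y)); rewrite distrC.
by move: c1 c2; lra.
Qed.

End Bounds.

(** * Cone obstacles: admissibility of the extremal and interior maxima *)

Section Obstacle.
Variables (R : realType) (p : R).
Hypothesis p_gt1 : 1 < p.
Local Notation mu := (@lebesgue_measure R).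
Implicit Types (u v z g psi : R -> R) (x y t h : R).

Lemma sym_cone_gt0 psi : sym_cone psi -> obstacle_assumptions psi -> 0 < psi (1 / 2).
Proof.
move=> [_ [[a [b ab]] [_ psis]]] [_ [psi0 [_ [x0 [/andP[x00 x01] px0]]]]].
have [y [/andP[y0 yh] py]] : exists y, 0 < y <= 1 / 2 /\ 0 < psi y.
  have [h|h] := leP x0 (1 / 2); first by exists x0; rewrite x00 h.
  exists (1 - x0); rewrite -psis; last by rewrite !ltW.
  by split => //; lra.
move: py psi0; rewrite !ab; [|lra..] => py psi0.
have : 0 < 2 * y * (a * (1 / 2) + b) by nra.
by rewrite pmulr_rgt0// mulr_gt0.
Qed.

(** On the left half the concave extremal lies above its chord from the origin to its top, and the
    chord lies above the affine obstacle, which is lower at both ends. Symmetry gives the right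
    half. *)
Lemma ext_above psi t del : sym_cone psi -> psi 0 < 0 -> 0 < t -> 0 <= del ->
  del < 1 / 2 -> psi (1 / 2) <= height p t del ->
  forall x, 0 <= x <= 1 -> psi x <= uext p t del x.
Proof.
move=> [_ [[a [b ab]] [_ psis]]] psi0 t0 d0 dl ph.
have sd := slope_ext p_gt1 t0 dl.
have left x : 0 <= x <= 1 / 2 -> psi x <= uext p t del x.
  move=> /andP[x0 xh].
  have cz : continuous (zext p t del) by exact: slope_continuous sd.
  have ci c d (f : R -> R) : continuous f -> mu.-integrable `[c, d] (EFin \o f).
    by move=> cf; apply: continuous_segment_integrable; exact: continuous_subspaceT.
  have cc (c : R) : continuous (fun _ : R => c) by move=> w; exact: cvg_cst.
  have u0 := uext0 p_gt1 t0 d0 dl; have uh := uext_half p_gt1 t0 dl.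
  have L : zext p t del x * (x - 0) <= uext p t del x.
    have x1 : x <= 1 by lra.
    have e := slope_primitive sd (lexx 0) x0 x1; rewrite u0 subr0 in e.
    rewrite e -Rintegral_segment_cst//; apply: le_Rintegral; [by []|exact: ci|exact: ci|].
    move=> s /=; rewrite in_itv/= => /andP[s0 sx].
    by apply: zext_nonincr => //; lra.
  have Rt : height p t del - uext p t del x <= zext p t del x * (1 / 2 - x).
    rewrite -uh (slope_primitive sd)//; last lra.
    rewrite -Rintegral_segment_cst//; apply: le_Rintegral; [by []|exact: ci|exact: ci|].
    move=> s /=; rewrite in_itv/= => /andP[xs sh].
    by apply: zext_nonincr => //; lra.
  move: psi0 ph; rewrite !ab ?x0 ?xh//; [|lra..] => psi0 ph.
  move: L Rt; set Z := zext _ _ _ _; set U := uext _ _ _ _; set H := height _ _ _.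
  move: ph; rewrite -/H => ph L Rt.
  (* Chord inequality: [L] times [1 / 2 - x] plus [Rt] times [x] eliminates the slope [Z]. *)
  have q : 2 * x * H <= U by nra.
  have q2 : 2 * x * (a * (1 / 2) + b) <= 2 * x * H by rewrite ler_wpM2l// mulr_ge0.
  have q3 : (1 - 2 * x) * b <= 0.
    by rewrite mulr_ge0_le0//; [lra|move: psi0; lra].
  by move: q q2 q3; lra.
move=> x /andP[x0 x1]; have [h|h] := leP x (1 / 2); first by apply: left; rewrite x0.
by rewrite psis ?x0// uext_sym; apply: left; lra.
Qed.

Lemma ext_in_Mset psi t del : sym_cone psi -> psi 0 < 0 -> 0 < t -> 0 <= del ->
  del < 1 / 2 -> psi (1 / 2) <= height p t del -> Mset p psi (uext p t del).
Proof.
move=> sc psi0 t0 d0 dl ph; have u0 := uext0 p_gt1 t0 d0 dl.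
split; first exact: slope_W2p (slope_ext p_gt1 t0 dl).
split=> //; split; first by rewrite uext_sym subrr.
exact: ext_above.
Qed.

(** Members of [Mset] may be asymmetric, so slope 0 is found at a maximum point; it is interior
    because [u] vanishes at the ends. The maximum is taken for [primitive z], which is
    differentiable on the whole line. *)
Lemma interior_max u z g : slope_data p u z g -> u 0 = 0 -> u 1 = 0 ->
  0 < u (1 / 2) -> exists2 xm, 0 < xm < 1 & z xm = 0 /\ u (1 / 2) <= u xm.
Proof.
move=> sd u0 u1 uh; have cz := slope_continuous sd.
have uE x : 0 <= x <= 1 -> u x = primitive z x.
  move=> /andP[x0 x1]; rewrite (@primitiveE R z 0 x)// Rintegral_segment0 subr0.
  by rewrite -(slope_primitive sd)// u0 subr0.
have dU x := is_derive_primitive x cz.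
have [|c] := @EVT_max R (primitive z) 0 1 ler01.
  by apply: continuous_subspaceT => x; exact: is_derive1_continuous (dU x).
rewrite in_itv/= => c01 cmax.
have uc : u (1 / 2) <= u c.
  by rewrite !uE//; [apply: cmax; rewrite in_itv/=; lra|lra].
have c01' : 0 < c < 1.
  move/andP : c01 => [c0 c1]; rewrite !lt_neqAle c0 c1 !andbT.
  apply/andP; split; apply/eqP => e; move: (lt_le_trans uh uc).
    by rewrite -e u0 ltxx.
  by rewrite e u1 ltxx.
exists c => //; split => //.
have d : is_derive c 1 (primitive z) 0.
  apply: (@derive1_at_max R (primitive z) 0 1 c ler01).
  - by move=> x _; have := dU x => -[].
  - by rewrite in_itv.
  - by move=> w; rewrite in_itv/= => /andP[w0 w1]; apply: cmax; rewrite in_itv/= !ltW.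
by rewrite -(@derive_val _ _ _ _ _ _ _ (dU c)); exact: derive_val.
Qed.

End Obstacle.

Theorem theorem1p2 (R : realType) (p : R) (hp : 1 < p) :
  exists hstar : R, 0 < hstar /\
    forall psi : R -> R, sym_cone psi -> obstacle_assumptions psi ->
      (psi (1 / 2) < hstar ->
         exists u, is_minimizer p (Msym p psi) u /\
           forall v, is_minimizer p (Msym p psi) v ->
             forall x, 0 <= x <= 1 -> v x = u x) /\
      (hstar <= psi (1 / 2) ->
         ~ exists u, is_minimizer p (Mset p psi) u).
Proof.
exists (hstar p); split; first exact: hstar_gt0.
move=> psi sc oa; have h0 := sym_cone_gt0 sc oa.
have psi0 : psi 0 < 0 by case: oa => _ [].
have h01 : 0 < (1 / 2 : R) < 1 by lra.
set h := psi (1 / 2) in h0 *; split => hh; last first.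
  move=> [u [[uW [u0 [u1 uge]]] umin]].
  have [z [g sd]] := W2p_slope uW.
  have huh : h <= u (1 / 2) by apply: uge; lra.
  have [xm xm01 [zxm hxm]] := interior_max sd u0 u1 (lt_le_trans h0 huh).
  have hum : h <= u xm by exact: le_trans hxm.
  have := energy_gt hp sd u0 u1 xm01 zxm hh hum.
  (* The energy of the supposed minimizer strictly exceeds (2K)^p, which leaves room for a
     competitor below it. *)
  move=> /(competitor_energy hp h0)[t t0 [dl hge lt]].
  have d0 : 0 <= h * t by rewrite mulr_ge0// ltW.
  have := umin _ (ext_in_Mset hp sc psi0 t0 d0 dl hge).
  by rewrite (Ep_slope hp sd) (Ep_ext hp t0 d0 dl) lee_fin leNgt lt.
have [t t0 [eh e1 e2]] := optimal_slope hp h0 hh.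
have dl : (0 : R) < 1 / 2 by lra.
have k0 : 0 < kext p t 0 by exact: kext_gt0.
have uM : Msym p psi (uext p t 0).
  split; last by move=> x _; exact: uext_sym.
  by apply: ext_in_Mset => //; rewrite eh.
have Eu := Ep_ext hp t0 (lexx 0) dl; rewrite eh in Eu.
have low v z g : Msym p psi v -> slope_data p v z g ->
    z (1 / 2) = 0 /\ h <= v (1 / 2).
  move=> [[_ [_ [_ vge]]] vs] sd; split; first exact: slope_sym_half sd vs.
  by apply: vge; lra.
exists (uext p t 0); split.
  split; first exact: uM.
  move=> v vM; have [vW [v0 [v1 vge]]] := vM.1.
  have [z [g sd]] := W2p_slope vW; have [zh hv] := low _ _ _ vM sd.
  have [ge _] := energy_ge hp sd v0 v1 h01 zh h0 hv t0 k0 e1 e2.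
  by rewrite Eu (Ep_slope hp sd) lee_fin.
move=> v [vM vmin]; have [[vW [v0 [v1 vge]]] vs] := vM.
have [z [g sd]] := W2p_slope vW; have [zh hv] := low _ _ _ vM sd.
have [_ eqc] := energy_ge hp sd v0 v1 h01 zh h0 hv t0 k0 e1 e2.
have Ele := vmin _ uM; rewrite Eu (Ep_slope hp sd) lee_fin in Ele.
have [tz1 D0] := eqc Ele.
have zle := slope_le_ext hp t0 sd zh tz1 D0.
have sdu := slope_ext hp t0 dl.
have incr x y : 0 <= x -> x <= y -> y <= 1 / 2 ->
    v y - v x <= uext p t 0 y - uext p t 0 x.
  move=> x0 xy yh; have y1 : y <= 1 by lra.
  rewrite (slope_primitive sd)// (slope_primitive sdu)//.
  have ci (f : R -> R) : continuous f ->
      (@lebesgue_measure R).-integrable `[x, y] (EFin \o f).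
    by move=> cf; apply: continuous_segment_integrable; exact: continuous_subspaceT.
  apply: le_Rintegral; [by []|exact/ci/(slope_continuous sd)| |].
    exact/ci/(slope_continuous sdu).
  move=> s /=; rewrite in_itv/= => /andP[xs sy]; apply: zle.
  by rewrite (le_trans x0)// (le_trans sy).
have u0 := uext0 hp t0 (lexx 0) dl; have uh := uext_half hp t0 dl.
(* The increments of [v] are at most those of the extremal. From 0 this gives [v <= uext]; up to
   1/2, where the obstacle forces [v] to be at least the top [h] of the extremal, it gives the
   reverse. *)
have left x : 0 <= x <= 1 / 2 -> v x = uext p t 0 x.
  move=> /andP[x0 xh]; apply/le_anti/andP; split.
    by have := incr 0 x (lexx 0) x0 xh; rewrite v0 u0 !subr0.
  by have := incr x (1 / 2) x0 xh (lexx _); rewrite uh eh; move: hv; lra.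
move=> x /andP[x0 x1]; have [hx|hx] := leP x (1 / 2); first by apply: left; rewrite x0.
by rewrite vs ?x0// uext_sym; apply: left; lra.
Qed.
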